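(* Let $\{\Lambda_i\}_{i=1}^N$ be i.i.d. positive random variables with common distribution function $F_\Lambda$, and let $\Lambda$ denote a generic copy. Suppose there exist constants $c>0$ and $\tau>3$ such that $1-F_\Lambda(x)\le c x^{1-\tau}$ for all $x\ge0$, and that $\nu:=\mathbb E[\Lambda^2]/\mathbb E[\Lambda]>1$. Then there exists an event $\mathcal J$, which occurs with probability tending to $1$ as $N\to\infty$, such that conditionally on $\{\Lambda_i\}_{i=1}^N$ satisfying $\mathcal J$, the capacities $\lambda_i=\Lambda_i$ satisfy conditions (C1)–(C3) with $$\mu=\mathbb E[\Lambda],\quad \nu=\frac{\mathbb E[\Lambda^2]}{\mathbb E[\Lambda]},\quad f_n=\mathbb E\Big[e^{-\Lambda}\frac{\Lambda^n}{n!}\Big],\quad g_n=\frac1\mu\mathbb E\Big[e^{-\Lambda}\frac{\Lambda^{n+1}}{n!}\Big]\quad(n\ge0).$$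
   Context: For capacities $\lambda_1,\dots,\lambda_N>0$ (here random: $\lambda_i=\Lambda_i$): $\mu_N=\frac1N\sum_i\lambda_i$, $\nu_N=\sum_i\lambda_i^2/\sum_i\lambda_i$, $f^{(N)}_n=\frac1N\sum_{i} e^{-\lambda_i}\frac{\lambda_i^n}{n!}$, $g^{(N)}_n=\frac{1}{N\mu_N}\sum_{i} e^{-\lambda_i}\frac{\lambda_i^{n+1}}{n!}$ ($n\ge0$); $d_{TV}(p,q)=\frac12\sum_j|p_j-q_j|$. (C1): there are $\mu\in(0,\infty)$, $\nu\in(1,\infty)$, $\alpha_1>0$ with $|\mu_N-\mu|=O(N^{-\alpha_1})$, $|\nu_N-\nu|=O(N^{-\alpha_1})$. (C2): there are sequences $\{f_n\}$, $\{g_n\}$ independent of $N$ and $\alpha_2>0$ with $d_{TV}(f^{(N)},f)=O(N^{-\alpha_2})$, $d_{TV}(g^{(N)},g)=O(N^{-\alpha_2})$. (C3): there is $\tau>3$ such that for every $\varepsilon>0$ (with $\gamma:=\frac1{\tau-1}+\varepsilon<\frac12$), $\limsup_N\frac1N\sum_i\lambda_i^{\tau-1-\varepsilon}<\infty$ and $\max_i\lambda_i\le N^\gamma$. *)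

(* Defs.v *)
From HB Require Import structures.
From mathcomp Require Import all_boot all_order all_algebra.
From mathcomp Require Import all_classical all_reals all_analysis.
Set Implicit Arguments. Unset Strict Implicit. Unset Printing Implicit Defensive.
Import Order.TTheory GRing.Theory Num.Theory.
Import numFieldNormedType.Exports.
Local Open Scope classical_set_scope.
Local Open Scope ring_scope.

Section defs.
Context {R : realType}.

(** Empirical quantities of the capacities lam 0, ..., lam (N-1)
    (the paper's lambda_1, ..., lambda_N). *)
Definition muN (lam : nat -> R) (N : nat) : R :=
  (N%:R)^-1 * \sum_(i < N) lam i.
Definition nuN (lam : nat -> R) (N : nat) : R :=
  (\sum_(i < N) lam i ^+ 2) / (\sum_(i < N) lam i).
Definition fN (lam : nat -> R) (N : nat) (n : nat) : R :=
  (N%:R)^-1 * \sum_(i < N) expR (- lam i) * lam i ^+ n / (n`!)%:R.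
Definition gN (lam : nat -> R) (N : nat) (n : nat) : R :=
  (N%:R * muN lam N)^-1 * \sum_(i < N) expR (- lam i) * lam i ^+ n.+1 / (n`!)%:R.

(** total variation distance of two sequences indexed by n >= 0
    (valued in the extended reals, so no summability side condition). *)
Definition dTV (p q : nat -> R) : \bar R :=
  ((2^-1)%:E * \sum_(0 <= n <oo) (`|p n - q n|)%:E)%E.

(** Conditions (C1)-(C3) for the random capacities lam s, s ranging over
    the realizations in the event J N (for each system size N).  The
    O(.)/limsup constants are uniform over the realizations in J N. *)
Definition condC1 {S : Type} (J : nat -> set S) (lam : S -> nat -> R)
    (mu nu : R) : Prop :=
  0 < mu /\ 1 < nu /\
  exists a1 : R, 0 < a1 /\ exists C : R, exists N0 : nat,
    forall N : nat, (N0 <= N)%N -> forall s, J N s ->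
      `|muN (lam s) N - mu| <= C * (N%:R) `^ (- a1) /\
      `|nuN (lam s) N - nu| <= C * (N%:R) `^ (- a1).

Definition condC2 {S : Type} (J : nat -> set S) (lam : S -> nat -> R)
    (f g : nat -> R) : Prop :=
  exists a2 : R, 0 < a2 /\ exists C : R, exists N0 : nat,
    forall N : nat, (N0 <= N)%N -> forall s, J N s ->
      (dTV (fN (lam s) N) f <= (C * (N%:R) `^ (- a2))%:E)%E /\
      (dTV (gN (lam s) N) g <= (C * (N%:R) `^ (- a2))%:E)%E.

Definition condC3 {S : Type} (J : nat -> set S) (lam : S -> nat -> R)
    (tau : R) : Prop :=
  3 < tau /\
  forall eps : R, 0 < eps -> (tau - 1)^-1 + eps < 2^-1 ->
    exists K : R, exists N0 : nat,
      forall N : nat, (N0 <= N)%N -> forall s, J N s ->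
        (N%:R)^-1 * \sum_(i < N) (lam s i) `^ (tau - 1 - eps) <= K /\
        (forall i : 'I_N, lam s i <= (N%:R) `^ ((tau - 1)^-1 + eps)).

End defs.

Definition distr_fun {d} {T : measurableType d} {R : realType}
  (P : probability T R) (X : T -> R) (x : R) : R :=
  fine (P [set w | X w <= x]).

Definition mutually_independent {d} {T : measurableType d} {R : realType}
  (P : probability T R) (X : nat -> T -> R) : Prop :=
  forall (I : seq nat) (B : nat -> set R), uniq I ->
    (forall i, measurable (B i)) ->
    P (\bigcap_(i in [set` I]) (X i @^-1` B i)) =
    (\prod_(i <- I) P (X i @^-1` B i))%E.

(* Main.v *)
Require Import Defs.
From HB Require Import structures.
From mathcomp Require Import all_boot all_order all_algebra.
From mathcomp Require Import all_classical all_reals all_analysis.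
From mathcomp Require Import measurable_realfun ring lra.
Import Order.TTheory GRing.Theory Num.Theory.
Import numFieldNormedType.Exports.
Local Open Scope classical_set_scope.
Local Open Scope ring_scope.

(** Everything reduces to L1 bounds [E|mean of Y - E Y| <= C N^-b], turned into
    likely events by Markov's inequality.  Pairwise independence gives
    [B / sqrt N] for variables bounded by [B], and truncation at [N^(1/4)]
    extends this to any [Y] with a finite moment of order [1 + dlt]; the tail
    assumption provides such moments for [Lambda], [Lambda^2] (as [tau > 3])
    and [Lambda^(tau-1-eps)].  For the total variation distances, the deviation
    of the [n]-th weight is at most both [(n+1) / sqrt N] and twice its mean;
    interpolating between the two and summing over [n] costs only the second
    moment of [Lambda].  Maxima are handled by a union bound, and a diagonal
    argument produces one event that serves all the [eps] of (C3) at once. *)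

(** * Empirical means of pairwise i.i.d. variables *)

(** Since [tau] may be close to 3, [Lambda^2] may have infinite variance, and Chebyshev's inequality
    cannot be applied to it directly. This is why deviations are measured in L1, and why the rates
    for means of powers depend on how much room the finite moments leave. Truncation at [N^(1/4)]
    costs [N^(-1/4)] on the bounded part and [N^(-dlt/4)] on the excess; as [dlt <= 1], the second
    rate governs. Markov's inequality then spends half of each exponent on the threshold and keeps
    the other half for the probability. Both [nuN] and [gN] are ratios of empirical means with
    denominator [muN]. They are treated deterministically, on the event where the means are accurate
    and for [N] so large that [muN >= mu / 2]. In (C3) a single event must serve uncountably many
    [eps]. The bound on the maximum weakens as [eps] grows, and so does the moment bound up to an
    additive 1, so the values [eps = 1/(k+1)] suffice. *)

Record pairwise_iid {d} {T : measurableType d} {R : realType}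
    (P : probability T R) (Y : nat -> T -> R) : Prop := PairwiseIid {
  iid_measurable : forall i, measurable_fun setT (Y i) ;
  iid_indep : forall i j, i != j -> forall A B, measurable A -> measurable B ->
    P (Y i @^-1` A `&` Y j @^-1` B) = (P (Y i @^-1` A) * P (Y j @^-1` B))%E ;
  iid_law : forall i A, measurable A -> P (Y i @^-1` A) = P (Y 0%N @^-1` A) }.

Lemma pairwise_iid_comp {d} {T : measurableType d} {R : realType}
    (P : probability T R) (Y : nat -> T -> R) (h : R -> R) :
  measurable_fun setT h -> pairwise_iid P Y ->
  pairwise_iid P (fun i w => h (Y i w)).
Proof.
move=> mh [mY indepY lawY].
have mhA A : measurable A -> measurable (h @^-1` A).
  by move=> mA; rewrite -[X in measurable X]setTI; exact: mh.
split=> [i|i j ij A B mA mB|i A mA].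
- exact: measurableT_comp.
- by apply: (indepY i j ij (h @^-1` A) (h @^-1` B)); exact: mhA.
- by apply: (lawY i (h @^-1` A)); exact: mhA.
Qed.

(** The open rays []x, +oo[] are stable under intersection, generate the Borel sets and exhaust the
    line, so a finite measure is determined by its values on them, which the distribution function
    gives. *)
Lemma law_of_distr_fun {d} {T : measurableType d} {R : realType}
    (P : probability T R) (X Y : T -> R) :
  measurable_fun setT X -> measurable_fun setT Y ->
  (forall x, distr_fun P X x = distr_fun P Y x) ->
  forall A, measurable A -> P (X @^-1` A) = P (Y @^-1` A).
Proof.
move=> mX mY XY A mA.
pose X' : {RV P >-> R} := HB.pack X (isMeasurableFun.Build _ _ _ _ X mX).
pose Y' : {RV P >-> R} := HB.pack Y (isMeasurableFun.Build _ _ _ _ Y mY).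
suff : distribution P X' A = distribution P Y' A by [].
apply: (@measure_unique _ R _ (@RGenOInfty.G R)
  (fun k => `]- k%:R, +oo[%classic)
  _ _ _ _ (distribution P X') (distribution P Y')) => //.
- exact: RGenOInfty.measurableE.
- move=> _ _ [x ->] [y ->]; exists (Num.max x y); apply/seteqP; split=> z /=;
    rewrite !in_itv/= !andbT gt_max; first by move=> [-> ->].
  by move/andP.
- by move=> k; exists (- k%:R).
- rewrite -subTset => x _; exists (Num.truncn `|x|).+1 => //=.
  rewrite in_itv/= andbT ltrNl (le_lt_trans (ler_norm _))// normrN.
  exact: truncnS_gt.
- move=> _ [x ->]; rewrite /distribution /pushforward.
  have ray (Z : T -> R) : measurable_fun setT Z ->
      P (Z @^-1` `]x, +oo[%classic) = (1 - (distr_fun P Z x)%:E)%E.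
    move=> mZ; have mZx : measurable [set w | Z w <= x].
      rewrite -[X in measurable X]setTI.
      by apply: (mZ measurableT `]-oo, x]%classic); exact: measurable_itv.
    have -> : Z @^-1` `]x, +oo[%classic = ~` [set w | Z w <= x].
      by apply/seteqP; split=> w /=; rewrite in_itv/= andbT ltNge => /negP.
    by rewrite probability_setC// /distr_fun fineK// fin_num_measure.
  by have := ray _ mX; rewrite XY -(ray _ mY).
- by move=> k; rewrite (le_lt_trans (probability_le1 _ _)) ?ltry//; exact: measurable_itv.
Qed.

Lemma pairwise_iid_distr {d} {T : measurableType d} {R : realType}
    (P : probability T R) (X : nat -> T -> R) :
  (forall i, measurable_fun setT (X i)) -> mutually_independent P X ->
  (forall i x, distr_fun P (X i) x = distr_fun P (X 0%N) x) ->
  pairwise_iid P X.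
Proof.
move=> mX indepX distrX; split=> // [i j ij A B mA mB|i A mA]; last first.
  exact: law_of_distr_fun.
have := indepX [:: i; j] (fun k => if k == i then A else B).
rewrite /= inE ij => /(_ isT) H.
have ji : (j == i) = false by rewrite eq_sym; exact/negbTE.
have -> : X i @^-1` A `&` X j @^-1` B = \bigcap_(k in [set` [:: i; j]])
    X k @^-1` (if k == i then A else B).
  apply/seteqP; split=> w /= => [[wA wB] k|wAB].
    rewrite /= !inE => /orP[/eqP ->|/eqP ->]; first by rewrite eqxx.
    by rewrite ji.
  split; first by have := wAB i; rewrite /= !inE eqxx; exact.
  by have := wAB j; rewrite /= !inE eqxx orbT ji; exact.
rewrite H; last by move=> k; case: ifP.
by rewrite big_cons big_seq1 eqxx ji.
Qed.

Lemma measurable_muN {d} {T : measurableType d} {R : realType}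
    (Y : nat -> T -> R) (N : nat) :
  (forall i, measurable_fun setT (Y i)) ->
  measurable_fun setT (fun w => muN (Y ^~ w) N).
Proof.
by move=> mY; apply: measurable_funM => //; exact: measurable_sum.
Qed.

Lemma muN_ge0 {R : realType} (y : nat -> R) (N : nat) :
  (forall i, 0 <= y i) -> 0 <= muN y N.
Proof. by move=> y0; rewrite mulr_ge0// ?invr_ge0// sumr_ge0. Qed.

Lemma le_muN {R : realType} (x y : nat -> R) (N : nat) :
  (forall i, x i <= y i) -> muN x N <= muN y N.
Proof.
by move=> xy; rewrite ler_wpM2l ?invr_ge0// ler_sum.
Qed.

(** * L1 deviation of empirical means from their expectation *)

Section deviation.
Context {d} {T : measurableType d} {R : realType} (P : probability T R).
Implicit Types Y : nat -> T -> R.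
Local Open Scope ereal_scope.

Lemma integral_iid Y (h : R -> \bar R) i :
  pairwise_iid P Y -> measurable_fun setT h -> (forall x, 0 <= h x) ->
  \int[P]_w h (Y i w) = \int[P]_w h (Y 0%N w).
Proof.
move=> [mY _ lawY] mh h0.
rewrite -[LHS](@ge0_integral_pushforward _ _ _ _ _ _ (mY i) P setT h)//.
rewrite -[RHS](@ge0_integral_pushforward _ _ _ _ _ _ (mY 0%N) P setT h)//.
by apply: eq_measure_integral => A mA _; exact: lawY.
Qed.

(** Independence makes the joint law agree with the product of the marginal laws on rectangles,
    hence everywhere, and Tonelli's theorem factors the integral. The positive parts in [g] give an
    integrand that is nonnegative on the whole plane and equals the product on the values taken by
    [Y]. *)
Lemma integral_indepM Y i j : pairwise_iid P Y -> (forall i w, (0 <= Y i w)%R) ->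
  i != j ->
  \int[P]_w (Y i w * Y j w)%:E = \int[P]_w (Y i w)%:E * \int[P]_w (Y j w)%:E.
Proof.
move=> [mY indepY _] Y0 ij.
have mYi := mY i; have mYj := mY j.
pose X1 : {RV P >-> R} := HB.pack (Y i) (isMeasurableFun.Build _ _ _ _ (Y i) mYi).
pose X2 : {RV P >-> R} := HB.pack (Y j) (isMeasurableFun.Build _ _ _ _ (Y j) mYj).
have mZ : measurable_fun setT (fun w => (Y i w, Y j w)) by exact: measurable_fun_pair.
pose Z : {RV P >-> (R * R)%type} :=
  HB.pack (fun w => (Y i w, Y j w)) (isMeasurableFun.Build _ _ _ _ _ mZ).
pose g (z : R * R) := (Num.max z.1 0 * Num.max z.2 0)%:E.
have mg : measurable_fun setT g.
  apply/measurable_EFinP; apply: measurable_funM; apply: measurable_maxr => //.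
have g0 z : 0 <= g z by rewrite lee_fin mulr_ge0// le_max lexx orbT.
have law : forall X, measurable X ->
    (distribution P X1 \x distribution P X2) X = distribution P Z X.
  by apply: product_measure_unique => A B mA mB; exact: indepY.
transitivity (\int[P]_w (g \o Z) w).
  by apply: eq_integral => w _; rewrite /g /= !max_l.
rewrite -(ge0_integral_distribution Z mg g0).
transitivity (\int[distribution P X1 \x distribution P X2]_z g z).
  by apply: eq_measure_integral => A mA _; exact/esym/law.
rewrite fubini_tonelli1//.
pose k (x : R) := (Num.max x 0)%:E.
have mk : measurable_fun setT k.
  by apply/measurable_EFinP; apply: measurable_maxr.
have k0 x : 0 <= k x by rewrite lee_fin le_max lexx orbT.
transitivity (\int[distribution P X1]_x (k x * \int[distribution P X2]_y k y)).
  apply: eq_integral => x _; rewrite /fubini_F /g /=.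
  under eq_integral do rewrite EFinM.
  rewrite (@ge0_integralZl_EFin _ _ _ _ _ _ k) => //.
  by rewrite le_max lexx orbT.
rewrite ge0_integralZr ?integral_ge0//.
congr (_ * _).
  rewrite (ge0_integral_distribution X1 mk k0).
  by apply: eq_integral => w _; rewrite /k /= max_l.
rewrite (ge0_integral_distribution X2 mk k0).
by apply: eq_integral => w _; rewrite /k /= max_l.
Qed.

Lemma integral_muN Y N : pairwise_iid P Y -> (forall i w, (0 <= Y i w)%R) ->
  (0 < N)%N -> \int[P]_w (muN (Y ^~ w) N)%:E = \int[P]_w (Y 0%N w)%:E.
Proof.
move=> iidY Y0 N0; have mY := iid_measurable _ _ iidY.
have NR0 : (0 < N%:R :> R)%R by rewrite ltr0n.
transitivity (\int[P]_w ((N%:R^-1)%:E * \sum_(i < N) (Y i w)%:E)).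
  by apply: eq_integral => w _; rewrite /muN EFinM sumEFin.
rewrite ge0_integralZl_EFin ?invr_ge0//; last 2 first.
- by move=> w _; apply: sume_ge0 => i _; rewrite lee_fin.
- by apply: emeasurable_sum => i; apply/measurable_EFinP.
rewrite ge0_integral_sum//; last 2 first.
- by move=> i; apply/measurable_EFinP.
- by move=> i w _; rewrite lee_fin.
have EY (i : 'I_N) : \int[P]_w (Y i w)%:E = \int[P]_w (Y 0%N w)%:E.
  (* [integral_iid] takes a test function that is nonnegative on the whole line; [Num.max x 0] is
     one, and it is the identity on the values of [Y]. *)
  have := @integral_iid Y (fun x => (Num.max x 0)%:E) i iidY.
  have -> : \int[P]_w (Num.max (Y i w) 0)%:E = \int[P]_w (Y i w)%:E.
    by apply: eq_integral => w _; rewrite max_l.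
  have -> : \int[P]_w (Num.max (Y 0%N w) 0)%:E = \int[P]_w (Y 0%N w)%:E.
    by apply: eq_integral => w _; rewrite max_l.
  apply; first by apply/measurable_EFinP; apply: measurable_maxr.
  by move=> x; rewrite lee_fin le_max lexx orbT.
rewrite (eq_bigr _ (fun i _ => EY i)) sumr_const card_ord.
rewrite [X in _ * X](_ : _ = N%:R%:E * \int[P]_w (Y 0%N w)%:E); last by rewrite mule_natl.
by rewrite muleA -EFinM mulVf ?gt_eqF// mul1e.
Qed.

(** The variance of the mean is at most [B^2 / N], and the L1 norm is at most the L2 norm. *)
Lemma mean_deviation_bounded Y (B : R) N : pairwise_iid P Y ->
  (forall i w, (0 <= Y i w <= B)%R) -> (0 < B)%R -> (0 < N)%N ->
  \int[P]_w (`|muN (Y ^~ w) N - fine (\int[P]_w (Y 0%N w)%:E)|%R)%:E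
    <= (B / Num.sqrt N%:R)%:E.
Proof.
move=> iidY YB B0 N0; have mY := iid_measurable _ _ iidY.
have Y0 i w : (0 <= Y i w)%R by have /andP[] := YB i w.
have NR0 : (0 < N%:R :> R)%R by rewrite ltr0n.
set s := Num.sqrt N%:R.
have s0 : (0 < s)%R by rewrite sqrtr_gt0.
have sE : (s ^+ 2 = N%:R)%R by rewrite sqr_sqrtr// ltW.
have EYB i : \int[P]_w (Y i w)%:E <= B%:E.
  rewrite -[leRHS]mule1 -(@probability_setT _ _ _ P) -integral_cst//.
  apply: ge0_le_integral => //.
  - by move=> w _; rewrite lee_fin.
  - exact/measurable_EFinP.
  - by move=> w _; rewrite lee_fin; have /andP[] := YB i w.
have EYfin i : \int[P]_w (Y i w)%:E \is a fin_num.
  rewrite ge0_fin_numE ?(le_lt_trans (EYB i)) ?ltry//.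
  by apply: integral_ge0 => w _; rewrite lee_fin.
set m := fine _.
have EY i : \int[P]_w (Y i w)%:E = m%:E.
  have := @integral_iid Y (fun x => (Num.max x 0)%:E) i iidY.
  have -> : \int[P]_w (Num.max (Y i w) 0)%:E = \int[P]_w (Y i w)%:E.
    by apply: eq_integral => w _; rewrite max_l.
  have -> : \int[P]_w (Num.max (Y 0%N w) 0)%:E = \int[P]_w (Y 0%N w)%:E.
    by apply: eq_integral => w _; rewrite max_l.
  rewrite /m fineK; first apply.
  - by apply/measurable_EFinP; apply: measurable_maxr.
  - by move=> x; rewrite lee_fin le_max lexx orbT.
  - exact: EYfin.
have m0 : (0 <= m)%R.
  by rewrite fine_ge0//; apply: integral_ge0 => w _; rewrite lee_fin.
(* Off the diagonal, independence gives exactly [m^2]. Only the [N] diagonal pairs cost more, at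
   most [B^2] each, which leaves [B^2 / N] after division by [N^2]. *)
have EYY i j : \int[P]_w (Y i w * Y j w)%:E <=
    (m ^+ 2 + (if i == j then B ^+ 2 else 0))%:E.
  case: eqVneq => [<-|ij]; last by rewrite integral_indepM// !EY addr0 expr2 EFinM.
  apply: (@le_trans _ _ (B ^+ 2)%:E); last by rewrite lee_fin lerDr sqr_ge0.
  rewrite -[leRHS]mule1 -(@probability_setT _ _ _ P) -integral_cst//.
  apply: ge0_le_integral => //.
  - by move=> w _; rewrite lee_fin mulr_ge0.
  - exact/measurable_EFinP/measurable_funM.
  - by move=> w _; rewrite lee_fin; have /andP[? ?] := YB i w; rewrite expr2 ler_pM.
set S := fun w => muN (Y ^~ w) N.
have S0 w : (0 <= S w)%R by exact: muN_ge0.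
have mS : measurable_fun setT S by exact: measurable_muN.
have ES : \int[P]_w (S w)%:E = m%:E by rewrite integral_muN// EY.
have ES2 : \int[P]_w (S w ^+ 2)%:E <= (m ^+ 2 + B ^+ 2 / N%:R)%:E.
  have -> : \int[P]_w (S w ^+ 2)%:E = \int[P]_w ((N%:R^-1 ^+ 2)%:E *
      \sum_(i < N) \sum_(j < N) (Y i w * Y j w)%:E).
    apply: eq_integral => w _; rewrite /S /muN exprMn EFinM; congr (_ * _).
    rewrite expr2 mulr_suml -sumEFin; apply: eq_bigr => i _.
    by rewrite mulr_sumr sumEFin.
  have mYY i j : measurable_fun setT (fun w => (Y i w * Y j w)%:E).
    exact/measurable_EFinP/measurable_funM.
  rewrite ge0_integralZl_EFin//; last 2 first.
  - by move=> w _; do 2! apply: sume_ge0 => ? _; rewrite lee_fin mulr_ge0.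
  - by do 2! apply: emeasurable_sum => ?.
  rewrite ge0_integral_sum//; last 2 first.
  - by move=> i; apply: emeasurable_sum.
  - by move=> i w _; apply: sume_ge0 => ? _; rewrite lee_fin mulr_ge0.
  have : \sum_(i < N) \int[P]_w (\sum_(j < N) (Y i w * Y j w)%:E) <=
      \sum_(i < N) (N%:R * m ^+ 2 + B ^+ 2)%:E.
    apply: lee_sum => i _; rewrite ge0_integral_sum//; last first.
      by move=> j w _; rewrite lee_fin mulr_ge0.
    apply: (le_trans (lee_sum _ (fun (j : 'I_N) _ => EYY i j))).
    rewrite sumEFin lee_fin big_split/= sumr_const card_ord mulr_natl lerD2l.
    by rewrite -big_mkcond/= (big_pred1 i)// => j; rewrite eq_sym.
  rewrite sumEFin sumr_const card_ord => H.
  apply: (le_trans (lee_wpmul2l _ H)); first by rewrite lee_fin sqr_ge0.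
  rewrite -EFinM lee_fin -[X in (_ * X)%R]mulr_natl le_eqVlt; apply/orP; left; apply/eqP.
  by field; rewrite ?gt_eqF.
rewrite -[leLHS]/(\int[P]_w (`|S w - m|%R)%:E); clearbody S.
have [a aE] : exists a, (a = s / B)%R by exists (s / B)%R.
have a0 : (0 < a)%R by rewrite aE divr_gt0.
have mD : measurable_fun setT (fun w => `|S w - m|%R).
  by apply: measurableT_comp => //; exact: measurable_funB.
(* AM-GM: |z| <= (a z^2 + 1/a)/2 with z = S - m and a = sqrt N / B, the cross
   term being moved to the left so that only nonnegative integrals occur. *)
have : \int[P]_w (`|S w - m|%:E + (a * m)%:E * (S w)%:E) <=
    \int[P]_w ((a / 2)%:E * (S w ^+ 2)%:E + (a / 2 * m ^+ 2 + (2 * a)^-1)%:E).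
  apply: ge0_le_integral => //.
  - by move=> w _; rewrite -EFinM -EFinD lee_fin addr_ge0 ?mulr_ge0 ?(ltW a0).
  - apply: emeasurable_funD; first exact/measurable_EFinP.
    by apply/measurable_EFinP; exact: measurable_funM.
  - apply: emeasurable_funD => //.
    by apply/measurable_EFinP; apply: measurable_funM => //; exact: measurable_funX.
  - move=> w _; rewrite -!EFinM -!EFinD lee_fin.
    have H : (`|S w - m| <= a / 2 * (S w - m) ^+ 2 + (2 * a)^-1)%R.
      have : (0 <= (a * `|S w - m| - 1) ^+ 2 / (2 * a))%R.
        by rewrite divr_ge0 ?sqr_ge0// mulr_ge0// ltW.
      rewrite -[in X in (_ <= X + _)%R]real_normK ?num_real//.
      set z := `|_|%R.
      have -> : ((a * z - 1) ^+ 2 / (2 * a) = a / 2 * z ^+ 2 + (2 * a)^-1 - z)%R.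
        by field; rewrite gt_eqF.
      lra.
    have E : (a / 2 * (S w - m) ^+ 2 =
        a / 2 * S w ^+ 2 + a / 2 * m ^+ 2 - a * m * S w)%R by field.
    rewrite E in H; lra.
rewrite ge0_integralD//; last 3 first.
- exact/measurable_EFinP.
- by move=> w _; rewrite -EFinM lee_fin !mulr_ge0// ltW.
- by apply/measurable_EFinP; exact: measurable_funM.
rewrite ge0_integralZl_EFin//; last 3 first.
- by move=> w _; rewrite lee_fin.
- exact/measurable_EFinP.
- by rewrite mulr_ge0// ltW.
rewrite ES.
rewrite ge0_integralD//; last 3 first.
- by move=> w _; rewrite -EFinM lee_fin mulr_ge0 ?sqr_ge0// divr_ge0// ltW.
- by apply/measurable_EFinP; apply: measurable_funM => //; exact: measurable_funX.
- move=> w _; rewrite lee_fin addr_ge0 ?mulr_ge0 ?invr_ge0 ?sqr_ge0 ?mulr_ge0// ltW//.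
have Ecst (r : R) : \int[P]_w r%:E = r%:E.
  by rewrite integral_cst// [X in _ * X](@probability_setT _ _ _ P) mule1.
rewrite Ecst.
rewrite ge0_integralZl_EFin//; last 3 first.
- by move=> w _; rewrite lee_fin sqr_ge0.
- by apply/measurable_EFinP; exact: measurable_funX.
- by rewrite divr_ge0// ltW.
have a20 : 0 <= (a / 2)%:E by rewrite lee_fin divr_ge0// ltW.
move=> H; have {H} := le_trans H (leeD2r _ (lee_wpmul2l a20 ES2)).
rewrite -!EFinM -EFinD -leeBrDr// => H; apply: (le_trans H).
(* With [a * m^2] subtracted, the terms in [m^2] cancel. What remains is [a B^2 / (2 N)] and
   [1 / (2 a)], and the choice [a = s / B] makes each equal to [B / (2 s)]. *)
rewrite -EFinB lee_fin -sE aE le_eqVlt; apply/orP; left; apply/eqP.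
by field; rewrite !gt_eqF.
Qed.

(** Triangle inequality, as the empirical mean has the same expectation as [Y 0]. There is no gain
    in [N], but the bound is small whenever the mean is: it serves the excess over a truncation
    level and the weights of large index. *)
Lemma mean_deviation_le_twice_mean Y N : pairwise_iid P Y ->
  (forall i w, (0 <= Y i w)%R) -> \int[P]_w (Y 0%N w)%:E < +oo -> (0 < N)%N ->
  \int[P]_w (`|muN (Y ^~ w) N - fine (\int[P]_w (Y 0%N w)%:E)|%R)%:E
    <= 2%:E * \int[P]_w (Y 0%N w)%:E.
Proof.
move=> iidY Y0 Yoo N0; have mY := iid_measurable _ _ iidY.
have EY0 : 0 <= \int[P]_w (Y 0%N w)%:E.
  by apply: integral_ge0 => w _; rewrite lee_fin.
have Yfin : \int[P]_w (Y 0%N w)%:E \is a fin_num by rewrite ge0_fin_numE.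
set m := fine _; have m0 : (0 <= m)%R by exact: fine_ge0.
have Em : \int[P]_w (Y 0%N w)%:E = m%:E by rewrite fineK.
have mS : measurable_fun setT (fun w => muN (Y ^~ w) N) by exact: measurable_muN.
apply: (@le_trans _ _ (\int[P]_w ((muN (Y ^~ w) N)%:E + m%:E))).
  apply: ge0_le_integral => //.
  - by apply/measurable_EFinP; apply: measurableT_comp => //; exact: measurable_funB.
  - by apply: emeasurable_funD => //; exact/measurable_EFinP.
  - move=> w _; rewrite -EFinD lee_fin (le_trans (ler_normB _ _))//.
    by rewrite !ger0_norm// muN_ge0.
rewrite ge0_integralD//; last 2 first.
- by move=> w _; rewrite lee_fin muN_ge0.
- exact/measurable_EFinP.
rewrite integral_cst// [X in _ * X](@probability_setT _ _ _ P) mule1.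
by rewrite integral_muN// Em -EFinD -EFinM lee_fin mulr_natl mulr2n.
Qed.

(** Splits [Y] as [min(Y, M) + max(Y - M, 0)]. Both pieces are images of [Y] under fixed measurable
    functions, hence again pairwise i.i.d.; the first is bounded by [M], and the second is charged
    twice its mean. *)
Lemma mean_deviation_truncated Y (M : R) N : pairwise_iid P Y ->
  (forall i w, (0 <= Y i w)%R) -> \int[P]_w (Y 0%N w)%:E < +oo ->
  (0 < M)%R -> (0 < N)%N ->
  \int[P]_w (`|muN (Y ^~ w) N - fine (\int[P]_w (Y 0%N w)%:E)|%R)%:E
    <= (M / Num.sqrt N%:R)%:E + 2%:E * \int[P]_w (Num.max (Y 0%N w - M) 0)%:E.
Proof.
move=> iidY Y0 Yoo M0 N0; have mY := iid_measurable _ _ iidY.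
pose u (x : R) := Num.min x M; pose v (x : R) := Num.max (x - M)%R 0%R.
have uvE x : (x = u x + v x)%R.
  rewrite /u /v; have [xM|Mx] := leP x M.
    by rewrite max_r ?addr0// subr_le0.
  by rewrite max_l ?subr_ge0 ?ltW// addrC subrK.
have mu : measurable_fun setT u by exact: measurable_minr.
have mv : measurable_fun setT v.
  by apply: measurable_maxr => //; exact: measurable_funB.
have iidU := pairwise_iid_comp _ _ _ mu iidY.
have iidV := pairwise_iid_comp _ _ _ mv iidY.
set U := (fun i w => u (Y i w)) in iidU; set V := (fun i w => v (Y i w)) in iidV.
have U0 i w : (0 <= U i w)%R by rewrite le_min Y0 ltW.
have V0 i w : (0 <= V i w)%R by rewrite le_max lexx orbT.
have mU := iid_measurable _ _ iidU; have mV := iid_measurable _ _ iidV.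
have EYE : \int[P]_w (Y 0%N w)%:E = \int[P]_w (U 0%N w)%:E + \int[P]_w (V 0%N w)%:E.
  rewrite -ge0_integralD//.
  - by apply: eq_integral => w _; rewrite -EFinD -uvE.
  - by move=> w _; rewrite lee_fin.
  - exact/measurable_EFinP.
  - by move=> w _; rewrite lee_fin.
  - exact/measurable_EFinP.
have EU0 : 0 <= \int[P]_w (U 0%N w)%:E.
  by apply: integral_ge0 => w _; rewrite lee_fin.
have EV0 : 0 <= \int[P]_w (V 0%N w)%:E.
  by apply: integral_ge0 => w _; rewrite lee_fin.
have EUoo : \int[P]_w (U 0%N w)%:E < +oo.
  by rewrite (le_lt_trans _ Yoo)// EYE leeDl.
have EVoo : \int[P]_w (V 0%N w)%:E < +oo.
  by rewrite (le_lt_trans _ Yoo)// EYE leeDr.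
rewrite EYE fineD ?ge0_fin_numE//.
have UV w : muN (Y ^~ w) N = (muN (U ^~ w) N + muN (V ^~ w) N)%R.
  rewrite /muN -mulrDr -big_split/=; congr (_ * _)%R.
  by apply: eq_bigr => i _; exact: uvE.
have HU : \int[P]_w (`|muN (U ^~ w) N - fine (\int[P]_w (U 0%N w)%:E)|%R)%:E
    <= (M / Num.sqrt N%:R)%:E.
  apply: mean_deviation_bounded => // i w.
  by rewrite U0 /U /u ge_min lexx orbT.
have HV := mean_deviation_le_twice_mean V N iidV V0 EVoo N0.
apply: (le_trans _ (leeD HU HV)).
have mdev (Z : nat -> T -> R) (z : R) : (forall i, measurable_fun setT (Z i)) ->
    measurable_fun setT (fun w => (`|muN (Z ^~ w) N - z|%R)%:E).
  move=> mZ; apply/measurable_EFinP; apply: measurableT_comp => //.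
  by apply: measurable_funB => //; exact: measurable_muN.
rewrite -ge0_integralD//; [|exact: mdev..].
apply: ge0_le_integral => //.
- exact: mdev.
- by apply: emeasurable_funD; exact: mdev.
- move=> w _; rewrite -EFinD lee_fin UV; apply: le_trans (ler_normD _ _).
  by rewrite le_eqVlt; apply/orP; left; apply/eqP; congr Num.norm; lra.
Qed.

Lemma mean_deviation_powR Y (dlt : R) : pairwise_iid P Y ->
  (forall i w, (0 <= Y i w)%R) -> (0 < dlt <= 1)%R ->
  \int[P]_w (Y 0%N w `^ (1 + dlt))%:E < +oo ->
  exists C : R, forall N, (0 < N)%N ->
    \int[P]_w (`|muN (Y ^~ w) N - fine (\int[P]_w (Y 0%N w)%:E)|%R)%:E
      <= (C * N%:R `^ (- (dlt / 4)))%:E.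
Proof.
move=> iidY Y0 /andP[d0 d1] Ydoo; have mY := iid_measurable _ _ iidY.
have mYd : measurable_fun setT (fun w => (Y 0%N w `^ (1 + dlt))%:E).
  by apply/measurable_EFinP; exact: (measurableT_comp (measurable_powR _) (mY 0%N)).
have Yoo : \int[P]_w (Y 0%N w)%:E < +oo.
  apply: (@le_lt_trans _ _ (\int[P]_w (1 + (Y 0%N w `^ (1 + dlt))%:E))).
    apply: ge0_le_integral => //.
    - by move=> w _; rewrite lee_fin.
    - exact/measurable_EFinP.
    - exact: emeasurable_funD.
    - move=> w _; rewrite -EFinD lee_fin; have [Y1|Y1] := leP (Y 0%N w) 1%R.
        by rewrite (le_trans Y1)// lerDl powR_ge0.
      by rewrite (le_trans (le1r_powR (ltW Y1) (_ : 1 <= 1 + dlt)%R)) ?lerDr// lerDl ltW.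
  rewrite ge0_integralD//; last by move=> w _; rewrite lee_fin powR_ge0.
  by rewrite integral_cst// [X in _ * X](@probability_setT _ _ _ P) mule1 lte_add_pinfty// ltry.
have EYd0 : 0 <= \int[P]_w (Y 0%N w `^ (1 + dlt))%:E.
  by apply: integral_ge0 => w _; rewrite lee_fin powR_ge0.
set D := fine (\int[P]_w (Y 0%N w `^ (1 + dlt))%:E).
have ED : \int[P]_w (Y 0%N w `^ (1 + dlt))%:E = D%:E.
  by rewrite fineK// ge0_fin_numE.
exists (1 + 2 * D)%R => N N0.
have N1 : (1 <= N%:R :> R)%R by rewrite ler1n.
have NR0 : (0 < N%:R :> R)%R by rewrite ltr0n.
pose M : R := (N%:R `^ 4^-1)%R.
have M0 : (0 < M)%R by exact: powR_gt0.
apply: (le_trans (mean_deviation_truncated Y M N iidY Y0 Yoo M0 N0)).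
rewrite mulrDl mul1r [leRHS]EFinD; apply: leeD.
  rewrite lee_fin -powR12_sqrt ?(ltW NR0)// /M -powRN -powRD ?(gt_eqF NR0) ?implybT//.
  by apply: ler_powR => //; lra.
rewrite -mulrA EFinM; apply: lee_wpmul2l; first by rewrite lee_fin.
have -> : (D * N%:R `^ (- (dlt / 4)))%:E = \int[P]_w ((N%:R `^ (- (dlt / 4)))%:E *
    (Y 0%N w `^ (1 + dlt))%:E).
  rewrite ge0_integralZl_EFin//; first by rewrite ED mulrC EFinM.
  by move=> w _; rewrite lee_fin powR_ge0.
apply: ge0_le_integral => //.
- by move=> w _; rewrite lee_fin le_max lexx orbT.
- by apply/measurable_EFinP; apply: measurable_maxr => //; exact: measurable_funB.
- exact: measurable_funeM.
- move=> w _; rewrite -EFinM lee_fin; have [YM|MY] := leP (Y 0%N w) M.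
    (* Below the level [M] the excess vanishes. Above it, [Y - M <= Y <= Y (Y / M)^dlt], and
       [M^(-dlt)] is [N^(-dlt/4)]. *)
    by rewrite max_r ?subr_le0// mulr_ge0 ?powR_ge0.
  have Yp : (0 < Y 0%N w)%R by exact: lt_trans MY.
  rewrite max_l ?subr_ge0 ?(ltW MY)//.
  apply: (@le_trans _ _ (Y 0%N w)); first by rewrite lerBlDr lerDl ltW.
  rewrite powRD ?(gt_eqF Yp) ?implybT// powRr1 ?(ltW Yp)// mulrCA -[leLHS]mulr1.
  apply: ler_wpM2l; first exact: ltW.
  have -> : (N%:R `^ (- (dlt / 4)) = (M `^ dlt)^-1)%R.
    by rewrite /M -powRrM -powRN; congr (_ `^ _)%R; lra.
  rewrite ler_pdivlMl ?powR_gt0// mulr1.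
  by apply: ge0_ler_powR; rewrite ?nnegrE ltW.
Qed.

Lemma nneseries_le_ub (u : nat -> \bar R) (b : \bar R) : (forall n, 0 <= u n) ->
  (forall K, \sum_(0 <= n < K) u n <= b) -> \sum_(0 <= n <oo) u n <= b.
Proof.
move=> u0 ub; apply: lime_le; first by apply: is_cvg_nneseries => n _ _.
by apply: nearW => K; exact: ub.
Qed.

Lemma nneseries_inv_sqr_le : \sum_(0 <= n <oo) ((n.+1%:R : R) ^- 2)%:E <= 2%:E.
Proof.
apply: nneseries_le_ub => [n|K]; first by rewrite lee_fin invr_ge0 sqr_ge0.
rewrite sumEFin lee_fin; case: K => [|K]; first by rewrite big_nil.
(* The correction [1/(K+1)] makes the induction telescope: [1/(x+1)^2 <= 1/x - 1/(x+1)]. *)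
suff : (\sum_(0 <= n < K.+1) (n.+1%:R : R) ^- 2 <= 2 - K.+1%:R^-1)%R.
  by move=> /le_trans; apply; rewrite gerBl invr_ge0.
elim: K => [|K IH]; first by rewrite big_nat1 expr1n invr1; lra.
rewrite big_nat_recr//=; apply: (le_trans (lerD IH (lexx _))).
have K0 : (0 < K.+1%:R :> R)%R by rewrite ltr0n.
rewrite -[K.+2%:R]natr1; set x : R := K.+1%:R%R in K0 *.
rewrite -subr_ge0 (_ : _ - _ = (x * (x + 1) ^+ 2)^-1)%R.
  by rewrite invr_ge0 mulr_ge0 ?sqr_ge0// ltW.
field; apply/andP; split; rewrite gt_eqF//; lra.
Qed.

(* The two bounds [(n+1)/sqrt N] and [2 E Y_n] are used respectively for
   [n+1 <= N^(1/8)] and [n+1 > N^(1/8)]; the former regime contributes the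
   summable weights [(n+1)^-2], the latter a first moment in [n]. *)
Lemma series_mean_deviation (Y : nat -> nat -> T -> R) :
  (forall n, pairwise_iid P (Y n)) ->
  (forall n i w, (0 <= Y n i w <= n.+1%:R)%R) ->
  \sum_(0 <= n <oo) (n.+1%:R)%:E * \int[P]_w (Y n 0%N w)%:E < +oo ->
  exists C : R, forall N, (0 < N)%N ->
    \int[P]_w (\sum_(0 <= n <oo)
       (`|muN (Y n ^~ w) N - fine (\int[P]_w (Y n 0%N w)%:E)|%R)%:E)
      <= (C * N%:R `^ (- 8^-1))%:E.
Proof.
move=> iidY YB Soo; have mY n := iid_measurable _ _ (iidY n).
have Y0 n i w : (0 <= Y n i w)%R by have /andP[] := YB n i w.
have EY0 n : 0 <= \int[P]_w (Y n 0%N w)%:E.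
  by apply: integral_ge0 => w _; rewrite lee_fin.
have EYB n : \int[P]_w (Y n 0%N w)%:E <= n.+1%:R%:E.
  rewrite -[leRHS]mule1 -(@probability_setT _ _ _ P) -integral_cst//.
  apply: ge0_le_integral => //.
  - by move=> w _; rewrite lee_fin.
  - exact/measurable_EFinP.
  - by move=> w _; rewrite lee_fin; have /andP[] := YB n 0%N w.
have EYoo n : \int[P]_w (Y n 0%N w)%:E < +oo by rewrite (le_lt_trans (EYB n)) ?ltry.
set S := \sum_(0 <= n <oo) _ in Soo.
have S0 : 0 <= S by apply: nneseries_ge0 => n _ _; rewrite mule_ge0// lee_fin.
have Sfin : S \is a fin_num by rewrite ge0_fin_numE.
exists (2 + 2 * fine S)%R => N N0.
have NR0 : (0 < N%:R :> R)%R by rewrite ltr0n.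
pose t : R := (N%:R `^ 8^-1)%R.
have t0 : (0 < t)%R by exact: powR_gt0.
have tE : (N%:R `^ (- 8^-1) = t^-1)%R by rewrite powRN.
have sE : (Num.sqrt N%:R = t ^+ 4)%R.
  rewrite -powR12_sqrt ?ltW// /t -powR_mulrn ?powR_ge0// -powRrM.
  by congr (_ `^ _)%R; field.
pose dev n w := (`|muN (Y n ^~ w) N - fine (\int[P]_w (Y n 0%N w)%:E)|%R)%:E.
have mdev n : measurable_fun setT (dev n).
  apply/measurable_EFinP; apply: measurableT_comp => //.
  by apply: measurable_funB => //; exact: measurable_muN.
have dev0 n w : 0 <= dev n w by rewrite lee_fin.
rewrite (integral_nneseries _ _ mdev)//.
(* With [t = N^(1/8)] and [x = n+1], both regimes gain the same factor [1/t]. If [x <= t], then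
   [x / t^4 <= t^-1 x^-2] amounts to [x^3 <= t^3]; if [x > t], then [1 <= x / t]. *)
have bnd n : \int[P]_w dev n w <= (t^-1)%:E *
    ((n.+1%:R ^- 2)%:E + 2%:E * (n.+1%:R%:E * \int[P]_w (Y n 0%N w)%:E)).
  have x0 : (0 < n.+1%:R :> R)%R by rewrite ltr0n.
  set x : R := n.+1%:R%R in x0 *.
  have EE : \int[P]_w (Y n 0%N w)%:E = (fine (\int[P]_w (Y n 0%N w)%:E))%:E.
    by rewrite fineK// ge0_fin_numE.
  have fE0 : (0 <= fine (\int[P]_w (Y n 0%N w)%:E))%R by exact: fine_ge0.
  have [xt|tx] := leP x t.
    apply: (@le_trans _ _ (x / Num.sqrt N%:R)%:E).
      exact: mean_deviation_bounded.
    rewrite EE -!EFinM lee_fin sE.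
    apply: (@le_trans _ _ (t^-1 * x ^- 2)%R); last first.
      by rewrite ler_wpM2l ?invr_ge0 ?(ltW t0)// lerDl !mulr_ge0// ltW.
    rewrite -invfM ler_pdivrMr ?exprn_gt0// ler_pdivlMl ?mulr_gt0 ?exprn_gt0//.
    have -> : (t * x ^+ 2 * x = t * x ^+ 3)%R by ring.
    rewrite (exprS t 3) ler_wpM2l ?(ltW t0)//.
    by rewrite lerXn2r ?nnegrE ?(ltW x0) ?(ltW t0).
  apply: (@le_trans _ _ (2%:E * \int[P]_w (Y n 0%N w)%:E)).
    exact: mean_deviation_le_twice_mean.
  rewrite EE -!EFinM lee_fin.
  rewrite mulrDr -[leLHS]add0r lerD ?mulr_ge0 ?invr_ge0 ?sqr_ge0 ?(ltW t0)//.
  rewrite ler_pdivlMl// mulrCA ler_wpM2l// ler_wpM2r//; exact: ltW.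
apply: (le_trans (lee_nneseries _ (fun n _ => bnd n))).
  by move=> n _ _; apply: integral_ge0 => w _.
have w0 n : 0 <= (n.+1%:R ^- 2 : R)%:E by rewrite lee_fin invr_ge0 sqr_ge0.
have W0 n : 0 <= 2%:E * (n.+1%:R%:E * \int[P]_w (Y n 0%N w)%:E).
  by rewrite !mule_ge0// lee_fin.
rewrite nneseriesZl; last 1 first.
  by move=> n _; rewrite adde_ge0.
rewrite nneseriesD//.
rewrite nneseriesZl; last by move=> n _; rewrite mule_ge0// lee_fin.
rewrite tE [in leRHS]mulrC EFinM; apply: lee_wpmul2l.
  by rewrite lee_fin invr_ge0 ltW.
rewrite [leRHS]EFinD; apply: leeD; first exact: nneseries_inv_sqr_le.
by rewrite EFinM fineK.
Qed.

End deviation.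

(** * Events of probability tending to one *)

Lemma powRN_eventually_le {R : realType} (C b e : R) : 0 < b -> 0 < e ->
  exists N0, (0 < N0)%N /\ forall N, (N0 <= N)%N -> C * N%:R `^ (- b) <= e.
Proof.
(* [x] solves [x^b = |C|/e + 1]; the added 1 keeps it positive even if [C = 0]. *)
move=> b0 e0; pose x := (`|C| / e + 1) `^ b^-1.
have d0 : 0 <= `|C| / e by rewrite divr_ge0// ltW.
exists (Num.truncn x).+1; split=> // N xN.
have x0 : 0 <= x by exact: powR_ge0.
have {xN} xN : x <= N%:R.
  by rewrite (le_trans (ltW (truncnS_gt x)))// ler_nat.
have N0 : 0 < N%:R :> R.
  by rewrite (lt_le_trans _ xN)// powR_gt0//; lra.
have Nb : `|C| / e + 1 <= N%:R `^ b.
  have -> : `|C| / e + 1 = x `^ b.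
    by rewrite /x -powRrM mulVf ?gt_eqF// powRr1//; lra.
  by apply: ge0_ler_powR; rewrite ?nnegrE// ltW.
rewrite powRN ler_pdivrMr ?powR_gt0//.
rewrite (le_trans (ler_norm C))// -ler_pdivrMl// mulrC; lra.
Qed.

Section with_high_probability.
Context {d} {T : measurableType d} {R : realType} (P : probability T R).
Implicit Types A B : nat -> set T.

(** Phrased through the complement, where union bounds and Markov's inequality act directly. *)
Definition whp A : Prop := (forall N, measurable (A N)) /\
  forall e : R, 0 < e -> exists N0, forall N, (N0 <= N)%N ->
    (P (~` A N) <= e%:E)%E.

Lemma whp_cvg A : whp A -> (fun N => P (A N)) @ \oo --> 1%E.
Proof.
move=> [mA PA].
have PE N : P (A N) = (1 - P (~` A N))%E.
  by rewrite -(probability_setC P (measurableC (mA N))) setCK.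
apply/fine_cvgP; split; first by apply: nearW => N; exact: fin_num_measure.
apply/cvgrPdist_le => e e0; have [N0 H] := PA e e0.
exists N0 => // N /= /H; have mAC := measurableC (mA N).
rewrite [P (A N)]PE fineB ?fin_num_measure//.
rewrite -[X in (X <= _)%E]fineK ?fin_num_measure// lee_fin => Pe.
by rewrite opprB addrC subrK ger0_norm ?fine_ge0// measure_ge0.
Qed.

Lemma whp_polynomial A (C b : R) : (forall N, measurable (A N)) -> 0 < b ->
  (forall N, (0 < N)%N -> (P (~` A N) <= (C * N%:R `^ (- b))%:E)%E) -> whp A.
Proof.
move=> mA b0 PA; split=> // e e0.
have [N0 [N00 H]] := powRN_eventually_le C b e b0 e0.
exists N0 => N N0N; rewrite (le_trans (PA N (leq_trans N00 N0N)))// lee_fin.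
exact: H.
Qed.

Lemma whp_setI A B : whp A -> whp B -> whp (fun N => A N `&` B N).
Proof.
move=> [mA PA] [mB PB]; split=> [N|e e0]; first exact: measurableI.
have e20 : 0 < e / 2 by lra.
have [N1 H1] := PA _ e20; have [N2 H2] := PB _ e20.
exists (maxn N1 N2) => N; rewrite geq_max => /andP[/H1 {}H1 /H2 {}H2].
rewrite setCI (le_trans (measureU2 _ _ _))//; [exact: measurableC..|].
by rewrite (_ : e%:E = (e / 2)%:E + (e / 2)%:E)%E ?leeD// -EFinD -splitr.
Qed.

(* Diagonal argument: [J N] is the intersection of the first [k(N)] events,
   where [k(N)] grows so slowly that the intersection stays likely. *)
Lemma whp_diagonal (A : nat -> nat -> set T) : (forall k, whp (A k)) ->
  exists J, whp J /\
    forall k, exists N0, forall N, (N0 <= N)%N -> J N `<=` A k N.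
Proof.
move=> wA; pose B k N := \big[setI/setT]_(j < k.+1) A j N.
have wB k : whp (B k).
  elim: k => [|k IH].
    have -> : B 0%N = A 0%N by apply/funext => N; rewrite /B big_ord1.
    exact: wA.
  have -> : B k.+1 = fun N => B k N `&` A k.+1 N.
    by apply/funext => N; rewrite /B big_ord_recr.
  exact: whp_setI.
have BA k j N : (j <= k)%N -> B k N `<=` A j N.
  by move=> jk; rewrite /B -(bigcap_mkord _ (fun j => A j N)) => w; apply; rewrite /= ltnS.
pose good N k := (P (~` B k N) <= (k.+1%:R^-1)%:E)%E.
(* Restricting to [k <= N] makes this a finite maximum. Without a good index it defaults to 0, which
   need not be good; [goodP] rules this out for large [N] and shows that [kk N] tends to
   infinity. *)
pose kk N := \max_(k < N.+1 | good N k) (k : nat).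
have goodP k : exists N0, forall N, (N0 <= N)%N -> (k <= kk N)%N /\ good N (kk N).
  have [N0 H] := (wB k).2 k.+1%:R^-1 ltac:(by rewrite invr_gt0 ltr0n).
  exists (maxn N0 k) => N; rewrite geq_max => /andP[/H gk kN].
  pose i0 := Ordinal (kN : (k < N.+1)%N); have gi0 : good N i0 by [].
  split; first by apply: (leq_bigmax_cond i0).
  rewrite /kk (bigop.bigmax_eq_arg i0)//.
  by case: arg_maxnP.
exists (fun N => B (kk N) N); split; last first.
  move=> k; have [N0 H] := goodP k; exists N0 => N /H[kN _]; exact: BA.
split=> [N|e e0]; first exact: (wB _).1.
have [k ke] : exists k, k.+1%:R^-1 <= e :> R.
  exists (Num.truncn e^-1); rewrite -[leRHS]invrK lef_pV2 ?posrE ?invr_gt0//.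
  exact/ltW/truncnS_gt.
have [N0 H] := goodP k; exists N0 => N /H[kN gN].
rewrite (le_trans gN)// lee_fin (le_trans _ ke)//.
by rewrite lef_pV2 ?posrE ?ltr0n// ler_nat ltnS.
Qed.

(** At threshold [N^(-b/2)] the failure probability is at most [C N^(-b) / N^(-b/2) = C N^(-b/2)].
    [Z] is extended-real valued so that infinite series of deviations are covered. *)
Lemma whp_markov (Z : nat -> T -> \bar R) (C b : R) :
  (forall N, measurable_fun setT (Z N)) -> (forall N w, 0 <= Z N w)%E -> 0 < b ->
  (forall N, (0 < N)%N -> (\int[P]_w Z N w <= (C * N%:R `^ (- b))%:E)%E) ->
  whp (fun N => [set w | Z N w <= (N%:R `^ (- (b / 2)))%:E]%E).
Proof.
move=> mZ Z0 b0 EZ.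
have mA N : measurable [set w | Z N w <= (N%:R `^ (- (b / 2)))%:E]%E.
  rewrite -[X in measurable X]setTI; exact: emeasurable_fun_infty_c.
apply: (@whp_polynomial _ C (b / 2)) => //; first by rewrite divr_gt0.
move=> N N0; have NR0 : 0 < N%:R :> R by rewrite ltr0n.
set a := N%:R `^ (- (b / 2)); have a0 : 0 < a by exact: powR_gt0.
have := @le_integral_comp_abse _ _ _ P setT measurableT (Z N) a id
  (@measurable_id _ _ _) (fun _ h => h) (fun _ _ _ _ h => h) (mZ N) a0.
rewrite setTI => H.
have {}H : (a%:E * P (~` [set w | Z N w <= a%:E]) <= (C * N%:R `^ (- b))%:E)%E.
  apply: (le_trans _ (EZ N N0)).
  have -> : (\int[P]_w Z N w = \int[P]_w `|Z N w|)%E.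
    by apply: eq_integral => w _; rewrite gee0_abs.
  apply: (le_trans _ H); apply: lee_wpmul2l; first by rewrite lee_fin ltW.
  apply: le_measure; rewrite ?inE.
  - exact/measurableC/mA.
  - rewrite -[X in measurable X]setTI; apply: emeasurable_fun_c_infty => //.
    exact: measurableT_comp.
  - by move=> w /= /negP; rewrite -ltNge gee0_abs// => /ltW.
have -> : C * a = a^-1 * (C * N%:R `^ (- b)).
  have -> : N%:R `^ (- b) = a * a.
    by rewrite /a -powRD ?(gt_eqF NR0) ?implybT//; congr (_ `^ _); field.
  by field; rewrite gt_eqF.
by rewrite EFinM lee_pdivlMl.
Qed.

(** Each of the [N] variables exceeds the level with probability at most [c N^(-g p)], so the
    failure probability is at most [c N^(1 - g p)]. *)
Lemma whp_max_le (X : nat -> T -> R) (c p g : R) :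
  (forall i, measurable_fun setT (X i)) ->
  (forall i (x : R), 0 < x -> (P [set w | (x < X i w)%R] <= (c * x `^ (- p))%:E)%E) ->
  1 < g * p ->
  whp (fun N => [set w | forall i : 'I_N, X i w <= N%:R `^ g]).
Proof.
move=> mX tailX gp.
have mgt i (x : R) : measurable [set w | (x < X i w)%R].
  rewrite (_ : [set w | _] = setT `&` X i @^-1` `]x, +oo[%classic); last first.
    by rewrite setTI; apply/seteqP; split=> w /=; rewrite in_itv/= andbT.
  by apply: mX => //; exact: measurable_itv.
have AE N : [set w | forall i : 'I_N, X i w <= N%:R `^ g] =
    ~` \bigcup_(i < N) [set w | (N%:R `^ g < X i w)%R].
  apply/seteqP; split=> w /= H.
    by move=> -[i /= iN]; rewrite ltNge (H (Ordinal iN)).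
  move=> i; rewrite leNgt; apply/negP => Hi; apply: H.
  by exists i => //=; exact: ltn_ord.
have mU N : measurable (\bigcup_(i < N) [set w | (N%:R `^ g < X i w)%R]).
  exact: bigcup_measurable.
apply: (@whp_polynomial _ c (g * p - 1)); last 2 first.
- by rewrite subr_gt0.
- move=> N N0; have NR0 : 0 < N%:R :> R by rewrite ltr0n.
  rewrite AE setCK bigcup_mkord.
  apply: (@le_trans _ _ (\sum_(i < N) P [set w | (N%:R `^ g < X i w)%R])%E).
    have := @Boole_inequality _ _ _ P (fun i => [set w | (N%:R `^ g < X i w)%R]) N.
    by apply => i _; exact: mgt.
  have : (\sum_(i < N) P [set w | (N%:R `^ g < X i w)%R] <=
      \sum_(i < N) (c * (N%:R `^ g) `^ (- p))%:E)%E.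
    by apply: lee_sum => i _; apply: tailX; exact: powR_gt0.
  move=> /le_trans; apply; rewrite sumEFin lee_fin sumr_const card_ord -[leLHS]mulr_natl.
  rewrite opprB -powRrM mulrN addrC powRD ?(gt_eqF NR0) ?implybT//.
  by rewrite powRr1 ?(ltW NR0)// le_eqVlt; apply/orP; left; apply/eqP; ring.
- by move=> N; rewrite AE; exact: measurableC.
Qed.

End with_high_probability.

(** * Poisson weights and moments *)

Section poisson_weights.
Context {R : realType}.
Implicit Types x : R.

Definition poisson_weight (n : nat) x : R := expR (- x) * x ^+ n / n`!%:R.

Lemma measurable_poisson_weight n : measurable_fun setT (poisson_weight n).
Proof.
apply: measurable_funM => //; apply: measurable_funM.
  by apply: measurableT_comp => //; exact: oppr_measurable.
exact: exprn_measurable.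
Qed.

Lemma poisson_weight_ge0 n x : 0 <= x -> 0 <= poisson_weight n x.
Proof. by move=> x0; rewrite !mulr_ge0 ?expR_ge0 ?exprn_ge0 ?invr_ge0. Qed.

(** Trades the size-biasing factor [x] for [n+1] and a shift of the index. The bound on the
    size-biased weights and the first moment in [n] both rest on it. *)
Lemma poisson_weightS n x :
  x * poisson_weight n x = n.+1%:R * poisson_weight n.+1 x.
Proof.
rewrite /poisson_weight factS natrM exprS.
have : n.+1%:R != 0 :> R by rewrite pnatr_eq0.
have : n`!%:R != 0 :> R by rewrite pnatr_eq0 -lt0n fact_gt0.
move: n.+1%:R n`!%:R => a b b0 a0.
by field; rewrite a0 b0.
Qed.

Lemma sum_poisson_weight_le1 K x : 0 <= x ->
  \sum_(0 <= n < K) poisson_weight n x <= 1.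
Proof.
move=> x0; rewrite -(expRxMexpNx_1 x) mulrC.
rewrite [leLHS](_ : _ = expR (- x) * series (exp_coeff x) K); last first.
  by rewrite /series/= mulr_sumr; apply: eq_bigr => n _; rewrite /exp_coeff/= mulrA.
rewrite ler_wpM2l ?expR_ge0//.
apply: (nondecreasing_cvgn_le _ (is_cvg_series_exp_coeff x)).
by apply: nondecreasing_series => n _ _; exact: exp_coeff_ge0.
Qed.

Lemma poisson_weight_le1 n x : 0 <= x -> poisson_weight n x <= 1.
Proof.
move=> x0; apply: le_trans (sum_poisson_weight_le1 n.+1 x x0).
rewrite big_nat_recr//= lerDr sumr_ge0// => i _; exact: poisson_weight_ge0.
Qed.

(** The full series is 1 plus the mean of a Poisson variable of parameter [x]. On partial sums,
    [n+1] is split into [1] and [n], and the shift identity turns the second part into [x] times a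
    shorter sum of weights. *)
Lemma sum_poisson_weight_moment_le K x : 0 <= x ->
  \sum_(0 <= n < K) n.+1%:R * poisson_weight n x <= 1 + x.
Proof.
move=> x0; case: K => [|K]; first by rewrite big_nil addr_ge0.
have -> : \sum_(0 <= n < K.+1) n.+1%:R * poisson_weight n x =
    \sum_(0 <= n < K.+1) poisson_weight n x +
    x * \sum_(0 <= n < K) poisson_weight n x.
  rewrite mulr_sumr [\sum_(0 <= n < K) _](eq_bigr _ (fun n _ => poisson_weightS n x)).
  rewrite [LHS](eq_bigr (fun n => poisson_weight n x + n%:R * poisson_weight n x)); last first.
    by move=> n _; rewrite -natr1; ring.
  by rewrite big_split/=; congr (_ + _); rewrite big_nat_recl//= mul0r add0r.
rewrite lerD ?sum_poisson_weight_le1// -[leRHS]mulr1 ler_wpM2l//.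
exact: sum_poisson_weight_le1.
Qed.

End poisson_weights.

(** * Finite moments from a polynomial tail *)

Lemma sum_geometric_le {R : realType} (r : R) K : 0 <= r < 1 ->
  \sum_(0 <= k < K) r ^+ k <= (1 - r)^-1.
Proof.
move=> /andP[r0 r1]; have r10 : 0 < 1 - r by rewrite subr_gt0.
suff -> : \sum_(0 <= k < K) r ^+ k = (1 - r ^+ K) / (1 - r).
  by rewrite ler_pdivrMr// mulVf ?gt_eqF// gerBl exprn_ge0.
elim: K => [|K IH]; first by rewrite big_nil expr0 subrr mul0r.
by rewrite big_nat_recr//= IH exprS; field; rewrite gt_eqF.
Qed.

(* Dyadic layers: [X^p <= 1 + sum_k 2^((k+1)p) 1_{X > 2^k}]. *)
Lemma moment_of_tail {d} {T : measurableType d} {R : realType}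
    (P : probability T R) (X : T -> R) (c p q : R) :
  measurable_fun setT X -> (forall w, 0 <= X w) -> 0 < p < q ->
  (forall x : R, 0 < x -> (P [set w | (x < X w)%R] <= (c * x `^ (- q))%:E)%E) ->
  (\int[P]_w (X w `^ p)%:E < +oo)%E.
Proof.
move=> mX X0 /andP[p0 pq] tailX.
pose A (k : nat) := [set w | ((2 ^+ k : R) < X w)%R].
have mA k : measurable (A k).
  rewrite (_ : A k = setT `&` X @^-1` `]2 ^+ k, +oo[%classic); last first.
    by rewrite setTI; apply/seteqP; split=> w /=; rewrite in_itv/= andbT.
  by apply: mX => //; exact: measurable_itv.
pose u k w : \bar R := (((2 ^+ k.+1 : R) `^ p)%:E * (\1_(A k) w)%:E)%E.
have u0 k w : (0 <= u k w)%E by rewrite mule_ge0// lee_fin ?powR_ge0.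
have mu k : measurable_fun setT (u k).
  by apply: measurable_funeM; apply/measurable_EFinP; exact: measurable_indic.
have pw w : ((X w `^ p)%:E <= 1 + \sum_(0 <= k <oo) u k w)%E.
  have S0 : (0 <= \sum_(0 <= k <oo) u k w)%E by apply: nneseries_ge0.
  have [X1|X1] := leP (X w) 1.
    rewrite -[leLHS]adde0 leeD// lee_fin (_ : 1 = 1 `^ p); last by rewrite powR1.
    by apply: ge0_ler_powR; rewrite ?nnegrE ?(ltW p0).
  have ex : exists n, X w <= 2 ^+ n.
    exists (Num.truncn (X w)).+1; rewrite (le_trans (ltW (truncnS_gt _)))//.
    by rewrite -natrX ler_nat ltnW// ltn_expl.
  (* Minimality puts [X w] in []2^m, 2^(m+1)]], so the single layer [u m w] already dominates [X w]
     to the power [p]; exponent 0 is excluded by [X w > 1]. *)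
  case: (ex_minnP ex) => -[|m] Xm minm.
    by move: Xm; rewrite expr0 leNgt X1.
  have Am : A m w.
    by rewrite /A /= ltNge; apply/negP => /minm; rewrite ltnn.
  apply: (@le_trans _ _ (u m w)).
    rewrite /u indicE mem_set// mule1 lee_fin.
    by apply: ge0_ler_powR; rewrite ?nnegrE ?(ltW p0)// exprn_ge0.
  rewrite -[leLHS]add0e leeD//.
  rewrite (nneseriesD1 (n := m))//.
  by apply: leeDl; apply: nneseries_ge0 => k _ _; exact: u0.
have mS : measurable_fun setT (fun w => \sum_(0 <= k <oo) u k w)%E.
  by apply: ge0_emeasurable_sum.
apply: (@le_lt_trans _ _ (\int[P]_w (1 + \sum_(0 <= k <oo) u k w))%E).
  apply: ge0_le_integral => //.
  - by move=> w _; rewrite lee_fin powR_ge0.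
  - by apply/measurable_EFinP; exact: (measurableT_comp (measurable_powR p) mX).
  - exact: emeasurable_funD.
rewrite ge0_integralD//; last by move=> w _; apply: nneseries_ge0.
rewrite integral_cst// [X in (_ * X)%E](@probability_setT _ _ _ P) mule1.
apply: lte_add_pinfty; first by rewrite ltry.
rewrite integral_nneseries//.
(* Layer [k] contributes at most [2^((k+1)p) c 2^(-kq) = c 2^p r^k], and [p < q] gives [r < 1]. *)
pose r : R := 2 `^ (p - q).
have r01 : 0 <= r < 1.
  rewrite powR_ge0 /r -[ltRHS](powRr0 (2 : R)) /powR ifF ?ifF; last 2 first.
  - by apply/negbTE; rewrite pnatr_eq0.
  - by apply/negbTE; rewrite pnatr_eq0.
  by rewrite ltr_expR ltr_pM2r ?ln_gt0 ?ltr1n// subr_lt0.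
have c0 : 0 <= c.
  have := le_trans (measure_ge0 P _) (tailX 1 ltr01).
  by rewrite lee_fin powR1 mulr1.
apply: (@le_lt_trans _ _ ((c * 2 `^ p) * (1 - r)^-1)%:E); last exact: ltry.
apply: nneseries_le_ub => [k|K]; first by apply: integral_ge0 => w _.
have bnd k : (\int[P]_w u k w <= (c * 2 `^ p * r ^+ k)%:E)%E.
  rewrite ge0_integralZl_EFin ?powR_ge0//; last first.
    by apply/measurable_EFinP; exact: measurable_indic.
  rewrite integral_indic// setIT.
  apply: (le_trans (lee_wpmul2l _ (tailX (2 ^+ k) _))).
  - by rewrite lee_fin powR_ge0.
  - exact: exprn_gt0.
  rewrite -EFinM lee_fin -!powR_mulrn ?ler0n ?powR_ge0// /r -!powRrM.
  rewrite mulrCA -mulrA ler_wpM2l// -!powRD ?pnatr_eq0 ?implybT//.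
  rewrite le_eqVlt; apply/orP; left; apply/eqP; congr (_ `^ _).
  by rewrite -natr1; ring.
apply: (le_trans (lee_sum _ (fun k _ => bnd k))).
rewrite sumEFin lee_fin -mulr_sumr ler_wpM2l ?mulr_ge0 ?powR_ge0//.
exact: sum_geometric_le.
Qed.

(** * Empirical quantities of a heavy-tailed sample *)

Section likely_events.
Context {d} {T : measurableType d} {R : realType} (P : probability T R).

Lemma whp_mean_deviation (Y : nat -> T -> R) (dlt : R) : pairwise_iid P Y ->
  (forall i w, 0 <= Y i w) -> 0 < dlt <= 1 ->
  (\int[P]_w (Y 0%N w `^ (1 + dlt))%:E < +oo)%E ->
  whp P (fun N => [set w | `|muN (Y ^~ w) N - fine (\int[P]_w (Y 0%N w)%:E)%E|
                             <= N%:R `^ (- (dlt / 8))]).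
Proof.
move=> iidY Y0 dlt01 Yoo; have mY := iid_measurable _ _ iidY.
have [C HC] := mean_deviation_powR P Y dlt iidY Y0 dlt01 Yoo.
have d40 : 0 < dlt / 4 by have /andP[] := dlt01; lra.
pose Z N w := (`|muN (Y ^~ w) N - fine (\int[P]_w (Y 0%N w)%:E)%E|)%:E.
have mZ N : measurable_fun setT (Z N).
  apply/measurable_EFinP; apply: measurableT_comp => //.
  by apply: measurable_funB => //; exact: measurable_muN.
have Z0 N w : (0 <= Z N w)%E by rewrite lee_fin.
have := @whp_markov _ _ _ P Z C (dlt / 4) mZ Z0 d40 HC.
by rewrite (_ : dlt / 4 / 2 = dlt / 8)//; field.
Qed.

(** Turns a pointwise envelope [G] of the weighted partial sums into the summability that the series
    deviation bound asks for. *)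
Lemma weighted_series_integral_le (Y : nat -> T -> R) (G : T -> R) :
  (forall n, measurable_fun setT (Y n)) -> measurable_fun setT G ->
  (forall n w, 0 <= Y n w) ->
  (forall K w, \sum_(0 <= n < K) n.+1%:R * Y n w <= G w) ->
  (\sum_(0 <= n <oo) (n.+1%:R)%:E * \int[P]_w (Y n w)%:E <= \int[P]_w (G w)%:E)%E.
Proof.
move=> mY mG Y0 YG; apply: nneseries_le_ub => [n|K].
  by rewrite mule_ge0 ?lee_fin//; apply: integral_ge0 => w _; rewrite lee_fin.
have mYn n : measurable_fun setT (fun w => (n.+1%:R * Y n w)%:E).
  by apply/measurable_EFinP; exact: measurable_funM.
have -> : (\sum_(0 <= n < K) (n.+1%:R)%:E * \int[P]_w (Y n w)%:E)%E =
    (\int[P]_w (\sum_(0 <= n < K) (n.+1%:R * Y n w)%:E))%E.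
  rewrite ge0_integral_sum//; last first.
    by move=> n w _; rewrite lee_fin mulr_ge0.
  apply: eq_bigr => n _; rewrite -ge0_integralZl_EFin//.
  - by move=> w _; rewrite lee_fin.
  - exact/measurable_EFinP.
apply: ge0_le_integral => //.
- by move=> w _; apply: sume_ge0 => n _; rewrite lee_fin mulr_ge0.
- exact: emeasurable_sum.
- exact/measurable_EFinP.
- by move=> w _; rewrite sumEFin lee_fin.
Qed.

Lemma whp_series_deviation (Y : nat -> nat -> T -> R) :
  (forall n, pairwise_iid P (Y n)) ->
  (forall n i w, 0 <= Y n i w <= n.+1%:R) ->
  (\sum_(0 <= n <oo) (n.+1%:R)%:E * \int[P]_w (Y n 0%N w)%:E < +oo)%E ->
  whp P (fun N => [set w | (\sum_(0 <= n <oo)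
    (`|muN (Y n ^~ w) N - fine (\int[P]_w (Y n 0%N w)%:E)|%R)%:E
      <= (N%:R `^ (- 16^-1))%:E)%E]).
Proof.
move=> iidY YB Yoo; have mY n := iid_measurable _ _ (iidY n).
have [C HC] := series_mean_deviation P Y iidY YB Yoo.
pose Z N w := (\sum_(0 <= n <oo)
    (`|muN (Y n ^~ w) N - fine (\int[P]_w (Y n 0%N w)%:E)|%R)%:E)%E.
have mZ N : measurable_fun setT (Z N).
  apply: ge0_emeasurable_sum => // n _.
  apply/measurable_EFinP; apply: measurableT_comp => //.
  by apply: measurable_funB => //; exact: measurable_muN.
have Z0 N w : (0 <= Z N w)%E by apply: nneseries_ge0.
have b0 : 0 < 8^-1 :> R by [].
have := @whp_markov _ _ _ P Z C 8^-1 mZ Z0 b0 HC.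
by rewrite (_ : 8^-1 / 2 = 16^-1 :> R)//; field.
Qed.

End likely_events.

(** * From empirical means to ratios and total variation *)

(** The error is [(a - b) / M - (M - m) b / (M m)], and [m / 2 <= M] allows [1/M] to be replaced by
    [2/m]. *)
Lemma dist_div_le {R : realFieldType} (a b M m : R) : 0 < m -> m / 2 <= M -> 0 <= b ->
  `|a / M - b / m| <= 2 / m * `|a - b| + 2 / m ^+ 2 * `|M - m| * b.
Proof.
move=> m0 mM b0; have M0 : 0 < M by lra.
have iM : M^-1 <= 2 / m by rewrite ler_pdivlMr// mulrC ler_pdivrMr//; lra.
have -> : a / M - b / m = M^-1 * (a - b) - M^-1 / m * (M - m) * b.
  by field; rewrite !gt_eqF.
apply: (le_trans (ler_normB _ _)); rewrite !normrM [`|M^-1|]ger0_norm ?invr_ge0 ?(ltW M0)//.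
rewrite [`|m^-1|]ger0_norm ?invr_ge0 ?(ltW m0)// [`|b|]ger0_norm//.
apply: lerD; first by rewrite ler_wpM2r.
rewrite ler_wpM2r// ler_wpM2r//.
rewrite (_ : 2 / m ^+ 2 = 2 / m / m); last by field; rewrite gt_eqF.
by rewrite ler_wpM2r// invr_ge0 ltW.
Qed.

Lemma nuN_muN {R : realType} (lam : nat -> R) N : (0 < N)%N ->
  nuN lam N = muN (fun i => lam i ^+ 2) N / muN lam N.
Proof.
by move=> N0; rewrite /nuN /muN invfM invrK mulrACA mulVf ?mul1r// pnatr_eq0 -lt0n.
Qed.

Lemma gN_muN {R : realType} (lam : nat -> R) N n :
  gN lam N n = muN (fun i => lam i * poisson_weight n (lam i)) N / muN lam N.
Proof.
rewrite /gN invfM mulrAC; congr (_ / _); rewrite /muN; congr (_ * _); apply: eq_bigr => i _.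
by rewrite /poisson_weight exprS; ring.
Qed.

(** Pointwise [x^p <= 1 + x^r]. A moment bound of (C3) for a small [eps] thereby gives one for every
    larger admissible [eps]. *)
Lemma muN_powR_le {R : realType} (x : nat -> R) (p r : R) N :
  (0 < N)%N -> (forall i, 0 <= x i) -> 0 < p <= r ->
  muN (fun i => x i `^ p) N <= 1 + muN (fun i => x i `^ r) N.
Proof.
move=> N0 x0 /andP[p0 pr].
have -> : 1 + muN (fun i => x i `^ r) N = muN (fun i => 1 + x i `^ r) N.
  rewrite /muN big_split/= sumr_const card_ord mulrDr mulVf//.
  by rewrite pnatr_eq0 -lt0n.
apply: le_muN => i; have [x1|x1] := leP (x i) 1.
  apply: (@le_trans _ _ 1); last by rewrite lerDl powR_ge0.
  rewrite [leRHS](_ : 1 = 1 `^ p); last by rewrite powR1.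
  by apply: ge0_ler_powR; rewrite ?nnegrE ?(ltW p0).
apply: (@le_trans _ _ (x i `^ r)); last by rewrite lerDr.
by rewrite ler_powR ?(ltW x1).
Qed.

Lemma dTV_le_sum {R : realType} (x y : nat -> R) :
  (dTV x y <= \sum_(0 <= n <oo) (`|x n - y n|%R)%:E)%E.
Proof.
rewrite /dTV -[leRHS]mul1e lee_wpmul2r ?nneseries_ge0// lee_fin; lra.
Qed.

(** Two errors add up: that of the numerators, at most [e] in total, and that of the denominator
    [muN], which enters each term multiplied by [G n] and is summable because [G] has finite total
    mass. *)
Lemma dTV_gN_le {R : realType} (lam : nat -> R) (G : nat -> \bar R) (mu e : R) N :
  (forall n, 0 <= G n)%E -> (\sum_(0 <= n <oo) G n < +oo)%E ->
  0 < mu -> mu / 2 <= muN lam N -> `|muN lam N - mu| <= e ->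
  (\sum_(0 <= n <oo)
     (`|muN (fun i => lam i * poisson_weight n (lam i)) N - fine (G n)|%R)%:E
     <= e%:E)%E ->
  (dTV (gN lam N) (fun n => mu^-1 * fine (G n))%R <=
    ((2 / mu + 2 / mu ^+ 2 * fine (\sum_(0 <= n <oo) G n)%E) * e)%:E)%E.
Proof.
move=> G0 SGoo mu0 Mge HM HG.
have SG0 : (0 <= \sum_(0 <= n <oo) G n)%E by exact: nneseries_ge0.
have SGE : (\sum_(0 <= n <oo) G n = (fine (\sum_(0 <= n <oo) G n))%:E)%E.
  by rewrite fineK// ge0_fin_numE.
have Gfin n : G n \is a fin_num.
  rewrite ge0_fin_numE// (le_lt_trans _ SGoo)// (nneseriesD1 (n := n))//.
  by apply: leeDl; exact: nneseries_ge0.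
have i0 : 0 <= 2 / mu by rewrite divr_ge0// ltW.
have j0 : 0 <= 2 / mu ^+ 2 by rewrite divr_ge0// sqr_ge0.
have e0 : 0 <= e by exact: le_trans HM.
pose D n := `|muN (fun i => lam i * poisson_weight n (lam i)) N - fine (G n)|.
have bnd n : ((`|gN lam N n - mu^-1 * fine (G n)|%R)%:E <= (2 / mu)%:E * (D n)%:E +
    (2 / mu ^+ 2 * e)%:E * G n)%E.
  rewrite gN_muN -[in X in (_ + X)%E](fineK (Gfin n)) -!EFinM lee_fin.
  rewrite [mu^-1 * _]mulrC.
  apply: (le_trans (dist_div_le _ _ _ _ mu0 Mge (fine_ge0 (G0 n)))).
  by rewrite lerD2l ler_wpM2r ?fine_ge0// ler_wpM2l.
apply: (le_trans (dTV_le_sum _ _)).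
apply: (le_trans (lee_nneseries _ (fun n _ => bnd n))) => //.
have c1 : (0 <= (2 / mu)%:E)%E by rewrite lee_fin.
have c2 : (0 <= (2 / mu ^+ 2 * e)%:E)%E by rewrite lee_fin mulr_ge0.
have D0 n : (0 <= (D n)%:E)%E by rewrite lee_fin normr_ge0.
rewrite nneseriesD; last 2 first.
- by move=> n _ _; rewrite mule_ge0.
- by move=> n _ _; rewrite mule_ge0.
rewrite !nneseriesZl//.
set K := fine _ in SGE *; rewrite SGE.
have -> : ((2 / mu + 2 / mu ^+ 2 * K) * e)%:E =
    ((2 / mu)%:E * e%:E + (2 / mu ^+ 2 * e)%:E * K%:E)%E.
  by rewrite mulrDl [2 / mu ^+ 2 * K * e]mulrAC EFinD EFinM [X in (_ + X)%E]EFinM.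
by rewrite leeD2r// lee_wpmul2l.
Qed.

Lemma nuN_dist_le {R : realType} (lam : nat -> R) (mu s e : R) N : (0 < N)%N ->
  0 <= s -> 0 < mu -> mu / 2 <= muN lam N -> `|muN lam N - mu| <= e ->
  `|muN (fun i => lam i ^+ 2) N - s| <= e ->
  `|nuN lam N - s / mu| <= (2 / mu + 2 / mu ^+ 2 * s) * e.
Proof.
move=> N0 s0 mu0 Mge HM HS; rewrite nuN_muN//.
apply: (le_trans (dist_div_le _ _ _ _ mu0 Mge s0)); rewrite [leRHS]mulrDl.
apply: lerD; first by rewrite ler_wpM2l// divr_ge0// ltW.
by rewrite [leRHS]mulrAC ler_wpM2r// ler_wpM2l// divr_ge0// sqr_ge0.
Qed.

Lemma probability_gt_distr_fun {d} {T : measurableType d} {R : realType} (P : probability T R)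
    (X : T -> R) (x : R) : measurable_fun setT X ->
  P [set w | (x < X w)%R] = (1 - distr_fun P X x)%:E.
Proof.
move=> mX; have mle : measurable [set w | X w <= x].
  rewrite (_ : [set w | _] = setT `&` X @^-1` `]-oo, x]%classic).
    by apply: mX => //; exact: measurable_itv.
  by rewrite setTI; apply/seteqP; split=> w /=; rewrite in_itv.
have -> : [set w | x < X w] = ~` [set w | X w <= x].
  by apply/seteqP; split=> w /=; rewrite ltNge => /negP.
by rewrite probability_setC// EFinB fineK// fin_num_measure.
Qed.

(** * Likely events for a sample with tail exponent [q > 2] *)

Section heavy_tailed_sample.
Context {d} {T : measurableType d} {R : realType} (P : probability T R).
Variables (X : nat -> T -> R) (c q : R).
Hypothesis iidX : pairwise_iid P X.
Hypothesis X0 : forall i w, 0 <= X i w.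
Hypothesis q2 : 2 < q.
Hypothesis tailX : forall i (x : R), 0 < x ->
  (P [set w | (x < X i w)%R] <= (c * x `^ (- q))%:E)%E.

Let mX := iid_measurable _ _ iidX.

Lemma sample_moment p : 0 < p < q -> (\int[P]_w (X 0%N w `^ p)%:E < +oo)%E.
Proof.
by move=> pq; exact: (moment_of_tail P (X 0%N) c p q (mX 0%N) (X0 0%N) pq (tailX 0%N)).
Qed.

Lemma sample_expectation_lty : (\int[P]_w (X 0%N w)%:E < +oo)%E.
Proof.
have : (0 : R) < 1 < q by rewrite ltr01 (lt_trans _ q2)// ltr1n.
by move/sample_moment; under eq_integral do rewrite powRr1//.
Qed.

Lemma sample_moment2_lty : (\int[P]_w (X 0%N w ^+ 2)%:E < +oo)%E.
Proof.
have : (0 : R) < 2 < q by rewrite ltr0n q2.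
by move/sample_moment; under eq_integral do rewrite powR_mulrn//.
Qed.

Lemma whp_sample_powR_deviation p : 0 < p < q -> exists b, 0 < b <= 8^-1 /\
  whp P (fun N => [set w |
    `|muN (fun i => X i w `^ p) N - fine (\int[P]_w (X 0%N w `^ p)%:E)%E|
      <= N%:R `^ (- b)]).
Proof.
(* Half of the room [q/p - 1], so that [p (1 + dl) < q] and the moment of that order is finite. *)
move=> /andP[p0 pq]; pose dl := Num.min 1 ((q / p - 1) / 2).
have qp : 1 < q / p by rewrite ltr_pdivlMr// mul1r.
have dl01 : 0 < dl <= 1 by rewrite lt_min ge_min lexx andbT; lra.
have dlq : dl <= (q / p - 1) / 2 by rewrite ge_min lexx orbT.
exists (dl / 8); split; first by lra.
have iidXp : pairwise_iid P (fun i w => X i w `^ p).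
  by apply: (pairwise_iid_comp P X (fun x => x `^ p)) => //; exact: measurable_powR.
apply: (whp_mean_deviation P _ dl iidXp (fun i w => powR_ge0 _ _) dl01).
under eq_integral do rewrite -powRrM.
apply: sample_moment; have /andP[dl0 _] := dl01.
rewrite mulr_gt0//=; last by lra.
rewrite mulrC -ltr_pdivlMr//; lra.
Qed.

Lemma whp_sample_poisson_weights :
  whp P (fun N => [set w | (\sum_(0 <= n <oo)
    (`|muN (fun i => poisson_weight n (X i w)) N -
       fine (\int[P]_w (poisson_weight n (X 0%N w))%:E)|%R)%:E
      <= (N%:R `^ (- 16^-1))%:E)%E]).
Proof.
pose F n i w := poisson_weight n (X i w).
have iidF n : pairwise_iid P (F n).
  by apply: (pairwise_iid_comp P X (poisson_weight n)) => //; exact: measurable_poisson_weight.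
have F01 n i w : 0 <= F n i w <= n.+1%:R.
  rewrite poisson_weight_ge0//= (le_trans (poisson_weight_le1 _ _ _))//.
  by rewrite ler1n.
apply: (whp_series_deviation P F iidF F01).
apply: (@le_lt_trans _ _ (\int[P]_w (1 + X 0%N w)%:E)%E).
  apply: (weighted_series_integral_le P (fun n => F n 0%N)).
  - by move=> n; exact: (iid_measurable _ _ (iidF n)).
  - exact: measurable_funD.
  - by move=> n w; have /andP[] := F01 n 0%N w.
  - by move=> K w; exact: sum_poisson_weight_moment_le.
under eq_integral do rewrite EFinD.
rewrite ge0_integralD//; last 2 first.
- by move=> w _; rewrite lee_fin.
- exact/measurable_EFinP.
rewrite integral_cst// [X in (X + _)%E](_ : _ = 1%E); last first.
  by rewrite [X in (_ * X)%E](@probability_setT _ _ _ P) mule1.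
by rewrite lte_add_pinfty ?ltry// sample_expectation_lty.
Qed.

Let Gw n i w := X i w * poisson_weight n (X i w).

Let iidG n : pairwise_iid P (Gw n).
Proof.
apply: (pairwise_iid_comp P X (fun x => x * poisson_weight n x)) => //.
by apply: measurable_funM => //; exact: measurable_poisson_weight.
Qed.

(** By the shift identity the size-biased weight is [n+1] times a Poisson weight, hence at most
    [n+1]. This is the origin of the bound [n.+1] in the series deviation lemma. *)
Let G01 n i w : 0 <= Gw n i w <= n.+1%:R.
Proof.
rewrite mulr_ge0 ?poisson_weight_ge0//= /Gw poisson_weightS.
by rewrite -[leRHS]mulr1 ler_wpM2l// poisson_weight_le1.
Qed.

(** The envelope is [X (1 + X)], where the finite second moment is spent. *)
Let SG :
  (\sum_(0 <= n <oo) (n.+1%:R)%:E * \int[P]_w (Gw n 0%N w)%:E < +oo)%E.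
Proof.
apply: (@le_lt_trans _ _ (\int[P]_w (X 0%N w + X 0%N w ^+ 2)%:E)%E).
  apply: (weighted_series_integral_le P (fun n => Gw n 0%N)).
  - by move=> n; exact: (iid_measurable _ _ (iidG n)).
  - by apply: measurable_funD => //; exact: measurable_funX.
  - by move=> n w; have /andP[] := G01 n 0%N w.
  - move=> K w; rewrite (_ : X 0%N w + _ = X 0%N w * (1 + X 0%N w)); last by ring.
    rewrite (eq_bigr (fun n => X 0%N w * (n.+1%:R * poisson_weight n (X 0%N w)))).
      by rewrite -mulr_sumr ler_wpM2l// sum_poisson_weight_moment_le.
    by move=> n _; rewrite mulrCA.
under eq_integral do rewrite EFinD.
rewrite ge0_integralD//.
- by rewrite lte_add_pinfty ?sample_expectation_lty ?sample_moment2_lty.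
- by move=> w _; rewrite lee_fin.
- exact/measurable_EFinP.
- by move=> w _; rewrite lee_fin sqr_ge0.
- by apply/measurable_EFinP; exact: measurable_funX.
Qed.

Lemma whp_sample_size_biased_weights :
  whp P (fun N => [set w | (\sum_(0 <= n <oo)
    (`|muN (fun i => X i w * poisson_weight n (X i w)) N -
       fine (\int[P]_w (X 0%N w * poisson_weight n (X 0%N w))%:E)|%R)%:E
      <= (N%:R `^ (- 16^-1))%:E)%E]).
Proof. exact: (whp_series_deviation P Gw iidG G01 SG). Qed.

Lemma sum_size_biased_weights_lty :
  (\sum_(0 <= n <oo) \int[P]_w (X 0%N w * poisson_weight n (X 0%N w))%:E < +oo)%E.
Proof.
have EG0 n : (0 <= \int[P]_w (Gw n 0%N w)%:E)%E.
  by apply: integral_ge0 => w _; rewrite lee_fin; have /andP[] := G01 n 0%N w.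
apply: le_lt_trans SG; apply: lee_nneseries => [n _ _|n _]; first exact: EG0.
by rewrite -[leLHS]mul1e lee_wpmul2r ?EG0// lee_fin ler1n.
Qed.

(** The level exponent satisfies [(1/q + e) q = 1 + e q > 1], as the union bound demands, and
    [e <= 1] keeps [q - e] positive. [K] is the true moment plus 1, since the deviation is at most
    [N^(-b) <= 1]. *)
Lemma whp_sample_C3 (e : R) : 0 < e <= 1 ->
  exists K, exists A : nat -> set T, whp P A /\
    forall N, (0 < N)%N -> forall w, A N w ->
      muN (fun i => X i w `^ (q - e)) N <= K /\
      forall i : 'I_N, X i w <= N%:R `^ (q^-1 + e).
Proof.
move=> /andP[e0 e1].
have pq : 0 < q - e < q by have q2' := q2; lra.
have q0 : 0 < q by exact: lt_trans q2.
have [b [/andP[b0 _] wp]] := whp_sample_powR_deviation _ pq.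
have wmax : whp P (fun N => [set w | forall i : 'I_N, X i w <= N%:R `^ (q^-1 + e)]).
  apply: (whp_max_le P X c q) => //.
  by rewrite mulrDl mulVf ?gt_eqF// ltrDl mulr_gt0.
set m := fine _ in wp.
exists (m + 1); eexists; split; first exact: (whp_setI P _ _ wp wmax).
move=> N N0 w [/= wpN wmaxN]; split=> //.
have : N%:R `^ (- b) <= 1 :> R.
  by rewrite -[leRHS](powRr0 (N%:R : R)) ler_powR ?ler1n// oppr_le0 ltW.
move=> Nb1; rewrite [m + 1]addrC -lerBlDr (le_trans _ Nb1)// (le_trans _ wpN)//.
exact: ler_norm.
Qed.

End heavy_tailed_sample.

(** * One event for all three conditions *)

Theorem theorem1p4 (d : measure_display) (T : measurableType d) (R : realType)
  (P : probability T R) (Lam : nat -> T -> R) (c tau : R) :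
  (forall i, measurable_fun setT (Lam i)) ->
  mutually_independent P Lam ->
  (forall i x, distr_fun P (Lam i) x = distr_fun P (Lam 0%N) x) ->
  (forall i w, 0 < Lam i w) ->
  0 < c -> 3 < tau ->
  (forall x : R, 0 < x -> 1 - distr_fun P (Lam 0%N) x <= c * x `^ (1 - tau)) ->
  1 < fine ('E_P[(fun w => Lam 0%N w ^+ 2)%R])%E / fine ('E_P[Lam 0%N])%E ->
  let mu := fine ('E_P[Lam 0%N])%E in
  let nu := fine ('E_P[(fun w => Lam 0%N w ^+ 2)%R])%E / mu in
  let f := fun n : nat =>
    fine ('E_P[(fun w => expR (- Lam 0%N w) * Lam 0%N w ^+ n / (n`!)%:R)%R])%E in
  let g := fun n : nat =>
    mu^-1 * fine ('E_P[(fun w => expR (- Lam 0%N w) * Lam 0%N w ^+ n.+1 / (n`!)%:R)%R])%E in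
  exists J : nat -> set T,
    (forall N, measurable (J N)) /\
    ((fun N => P (J N)) @ \oo --> 1%E) /\
    let lam := fun (w : T) (i : nat) => Lam i w in
    condC1 J lam mu nu /\ condC2 J lam f g /\ condC3 J lam tau.
Proof.
move=> mX indepX distrX X0 c0 tau3 tail nu1 mu nu f g.
have iidX := pairwise_iid_distr P Lam mX indepX distrX.
have X0' i w : 0 <= Lam i w by exact: ltW.
have EE (Y : T -> R) : ('E_P[Y] = \int[P]_w (Y w)%:E)%E by rewrite unlock.
have [q qE] : exists q, tau - 1 = q by exists (tau - 1).
have q2 : 2 < q by lra.
have tailX i (x : R) : 0 < x ->
    (P [set w | (x < Lam i w)%R] <= (c * x `^ (- q))%:E)%E.
  by move=> x0; rewrite probability_gt_distr_fun// distrX lee_fin -qE opprB tail.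
have mu0 : 0 < mu.
  have : 0 <= mu.
    by rewrite /mu EE fine_ge0//; apply: integral_ge0 => w _; rewrite lee_fin.
  (* If [mu] were 0, division by zero would make the ratio 0, contradicting that it exceeds 1. *)
  rewrite le_eqVlt => /orP[/eqP mu0|//].
  by move: nu1; rewrite -/mu -mu0 invr0 mulr0 ltr10.
have q01 : (0 : R) < 1 < q by lra.
have q02 : (0 : R) < 2 < q by lra.
have [bM [bM01 wM]] := whp_sample_powR_deviation P Lam c q iidX X0' tailX _ q01.
have [bS [bS01 wS]] := whp_sample_powR_deviation P Lam c q iidX X0' tailX _ q02.
have wF := whp_sample_poisson_weights P Lam c q iidX X0' q2 tailX.
have wG := whp_sample_size_biased_weights P Lam c q iidX X0' q2 tailX.
have SG := sum_size_biased_weights_lty P Lam c q iidX X0' q2 tailX.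
have eps01 k : 0 < (k.+1%:R^-1 : R) <= 1.
  by rewrite invr_gt0 ltr0n invf_le1 ?ltr0n// ler1n.
have [K3 wC3] := choice (fun k =>
  whp_sample_C3 P Lam c q iidX X0' q2 tailX k.+1%:R^-1 (eps01 k)).
have {wC3} [A3 wA3] := choice wC3.
pose s := fine (\int[P]_w (Lam 0%N w ^+ 2)%:E)%E.
have s0 : 0 <= s.
  by apply: fine_ge0; apply: integral_ge0 => w _; rewrite lee_fin sqr_ge0.
pose b := Num.min bM bS.
have bbM : b <= bM by rewrite ge_min lexx.
have bbS : b <= bS by rewrite ge_min lexx orbT.
have b0 : 0 < b by rewrite lt_min; lra.
have powR_anti (N : nat) (x y : R) : (0 < N)%N -> x <= y ->
    N%:R `^ (- y) <= N%:R `^ (- x) :> R.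
  by move=> Npos xy; rewrite ler_powR ?ler1n// lerN2.
have [A0 [wA0 A0P]] : exists A0 : nat -> set T, whp P A0 /\
    forall N w, (0 < N)%N -> A0 N w -> [/\ `|muN (Lam ^~ w) N - mu| <= N%:R `^ (- b),
      `|muN (fun i => Lam i w ^+ 2) N - s| <= N%:R `^ (- b),
      (\sum_(0 <= n <oo) (`|muN (fun i => poisson_weight n (Lam i w)) N -
         fine (\int[P]_w (poisson_weight n (Lam 0%N w))%:E)|%R)%:E
        <= (N%:R `^ (- 16^-1))%:E)%E &
      (\sum_(0 <= n <oo) (`|muN (fun i => Lam i w * poisson_weight n (Lam i w)) N -
         fine (\int[P]_w (Lam 0%N w * poisson_weight n (Lam 0%N w))%:E)|%R)%:E
        <= (N%:R `^ (- 16^-1))%:E)%E].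
  eexists; split.
    exact: (whp_setI P _ _ (whp_setI P _ _ wM wS) (whp_setI P _ _ wF wG)).
  move=> N w Npos [[/= wMN wSN] [/= wFN wGN]]; split=> //.
    apply: le_trans (powR_anti _ _ _ Npos bbM); apply: le_trans wMN.
    rewrite le_eqVlt; apply/orP; left; apply/eqP; congr `|_ - _|.
      by congr (_ * _); apply: eq_bigr => i _; rewrite powRr1.
    by rewrite /mu EE; congr fine; apply: eq_integral => u _; rewrite powRr1.
  apply: le_trans (powR_anti _ _ _ Npos bbS); apply: le_trans wSN.
  rewrite le_eqVlt; apply/orP; left; apply/eqP; congr `|_ - _|.
    by congr (_ * _); apply: eq_bigr => i _; rewrite powR_mulrn.
  by congr fine; apply: eq_integral => u _; rewrite powR_mulrn.
(* Index 0 carries the event behind (C1) and (C2); index [k+1] carries the event of (C3) for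
   [eps = 1/(k+1)]. *)
have [J [wJ JA]] : exists J, whp P J /\
    forall k, exists N0, forall N, (N0 <= N)%N ->
      J N `<=` (if k is k'.+1 then A3 k' else A0) N.
  by apply: whp_diagonal => -[//|k]; have [] := wA3 k.
have [N0 JA0] := JA 0%N.
have mu20 : 0 < mu / 2 by rewrite divr_gt0.
(* From [N1] on, the deviation [N^(-b)] is at most [mu / 2], so [muN >= mu / 2] on the event and the
   ratio bounds apply. *)
have [N1 [N10 HN1]] := powRN_eventually_le 1 b (mu / 2) b0 mu20.
have good N w : (maxn N0 N1 <= N)%N -> J N w ->
    [/\ (0 < N)%N, A0 N w & mu / 2 <= muN (Lam ^~ w) N].
  rewrite geq_max => /andP[NN0 NN1] JNw.
  have Npos : (0 < N)%N by exact: leq_trans NN1.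
  have A0w : A0 N w by exact: (JA0 N NN0).
  split=> //; have [+ _ _ _] := A0P _ _ Npos A0w; have := HN1 N NN1.
  by rewrite mul1r ler_norml => H /andP[H' _]; lra.
have i0 : 0 <= 2 / mu by rewrite divr_ge0// ltW.
have j0 : 0 <= 2 / mu ^+ 2 by rewrite divr_ge0// sqr_ge0.
exists J; split; first exact: wJ.1.
split; first exact: whp_cvg.
move=> lam; split; last split.
- split=> //; split=> //; exists b; split=> //.
  exists (1 + (2 / mu + 2 / mu ^+ 2 * s)), (maxn N0 N1) => N NN w JNw.
  have [Npos A0w Mge] := good N w NN JNw.
  have [HM HS _ _] := A0P _ _ Npos A0w.
  split.
    rewrite (le_trans HM)// -[leLHS]mul1r ler_wpM2r ?powR_ge0// lerDl.
    by rewrite addr_ge0// mulr_ge0.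
  rewrite /nu EE -/s (le_trans (nuN_dist_le _ _ _ _ _ Npos s0 mu0 Mge HM HS))//.
  by rewrite ler_wpM2r ?powR_ge0// lerDr.
(* The series deviations decay like [N^(-1/16)], but [gN] also inherits the rate [b] of its
   denominator [muN]. *)
- pose a := Num.min b 16^-1.
  have ab : a <= b by rewrite ge_min lexx.
  have a16 : a <= 16^-1 by rewrite ge_min lexx orbT.
  exists a; split; first by rewrite lt_min b0 invr_gt0 ltr0n.
  pose KG := fine (\sum_(0 <= n <oo)
    \int[P]_w (Lam 0%N w * poisson_weight n (Lam 0%N w))%:E)%E.
  have EG0 n : (0 <= \int[P]_w (Lam 0%N w * poisson_weight n (Lam 0%N w))%:E)%E.
    apply: integral_ge0 => w _; rewrite lee_fin mulr_ge0//.
    exact: poisson_weight_ge0.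
  have KG0 : 0 <= KG by apply: fine_ge0; exact: nneseries_ge0.
  exists (1 + (2 / mu + 2 / mu ^+ 2 * KG)), (maxn N0 N1) => N NN w JNw.
  have [Npos A0w Mge] := good N w NN JNw.
  have [HM _ HF HG] := A0P _ _ Npos A0w.
  have ea := powR_anti N _ _ Npos ab; have e16 := powR_anti N _ _ Npos a16.
  split.
    apply: (le_trans (dTV_le_sum _ _)).
    apply: (@le_trans _ _ (N%:R `^ (- 16^-1))%:E).
      apply: le_trans HF; apply: lee_nneseries => // n _.
      by rewrite /f EE.
    rewrite lee_fin (le_trans e16)// -[leLHS]mul1r ler_wpM2r ?powR_ge0// lerDl.
    by rewrite addr_ge0// mulr_ge0.
  have -> : g = fun n => mu^-1 * fine (\int[P]_w
      (Lam 0%N w * poisson_weight n (Lam 0%N w))%:E)%E.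
    apply/funext => n; rewrite /g EE; congr (_ * fine _).
    apply: eq_integral => u _; congr (_%:E).
    by rewrite /poisson_weight exprS; ring.
  have HM' := le_trans HM ea.
  have e16' : ((N%:R `^ (- 16^-1))%:E <= (N%:R `^ (- a))%:E)%E by rewrite lee_fin.
  have HG' := le_trans HG e16'.
  apply: (le_trans (dTV_gN_le _ _ _ _ _ EG0 SG mu0 Mge HM' HG')).
  by rewrite lee_fin ler_wpM2r ?powR_ge0// lerDr.
- split=> // ep ep0; rewrite qE => epq.
  (* With [1/(k+1) <= ep], the event gives a moment of order at least [q - ep] and a maximum bound
     with exponent at most [1/q + ep]. *)
  have [k kep] : exists k, k.+1%:R^-1 <= ep.
    exists (Num.truncn ep^-1); rewrite -[leRHS]invrK lef_pV2 ?posrE ?invr_gt0//.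
    exact/ltW/truncnS_gt.
  have [N2 JA2] := JA k.+1.
  exists (1 + K3 k), (maxn N2 1) => N; rewrite geq_max => /andP[NN2 Npos] w JNw.
  have [_ /(_ N Npos w (JA2 N NN2 w JNw))[Hmom Hmax]] := wA3 k.
  have iq0 : 0 < q^-1 by rewrite invr_gt0; lra.
  split; last first.
    by move=> i; rewrite (le_trans (Hmax i))// ler_powR ?ler1n// lerD2l.
  apply: (@le_trans _ _ (1 + muN (fun i => Lam i w `^ (q - k.+1%:R^-1)) N)).
    apply: muN_powR_le => // [i|]; first exact: X0'.
    (* [1/q + ep < 1/2] forces [ep < 1/2 < q], so the exponent [q - ep] is positive. *)
    have ep2 : ep < 2^-1 by rewrite (le_lt_trans _ epq)// lerDr ltW.
    rewrite lerD2l lerN2 kep andbT subr_gt0 (lt_trans ep2)// (lt_trans _ q2)//.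
    lra.
  by rewrite lerD2l.
Qed.
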